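(* Let $p$ be a prime and let $\Gamma$ be a finitely generated orientable Fuchsian group given by the standard presentation $$\langle X|R\rangle=\big\langle x_1,\ldots,x_r,u_1,v_1,\ldots,u_s,v_s\,\big|\,x_1^{e_1}=\cdots=x_r^{e_r}=x_1\cdots x_r[u_1,v_1]\cdots[u_s,v_s]=1\big\rangle,$$ where $\nu_p(e_1)\geq\dots\geq\nu_p(e_r)$. Suppose that one of the following statements holds true: (1) $s\geq 1$; (2) $p\geq 3$, and $e_1,e_2,e_3$ are divisible by $p$; (3) $p=2$, and $e_1,e_2,e_3,e_4$ are even; (4) $p=2$, $e_1$ and $e_2$ are divisible by $4$, and $e_3$ is even. Then $\mathrm{def}_p\,\Gamma=\mathrm{def}_p\langle X|R\rangle$, i.e. $\mathrm{def}_p\,\Gamma=2s-2+\sum_{i=1}^r\left(1-p^{-\nu_p(e_i)}\right)$. If none of these conditions holds true, then $\mathrm{def}_p\,\Gamma<0$.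
   Context: For an integer $n$, $\nu_p(n)$ is the largest $k$ such that $p^k$ divides $n$. The $x_i$ are the elliptic generators of the Fuchsian group, of orders $e_i\geq 2$; $\Gamma$ contains no parabolic elements. Conditions mentioning $e_3$ or $e_4$ presuppose that $r\geq 3$ or $r\geq 4$, respectively. Let $F$ be the free group on a finite set $X$. For a non-trivial $w\in F$, the $p$-valuation $\nu_p(w)$ is the largest integer $k$ such that $w=v^{p^k}$ for some $v\in F$. For a presentation $\langle X|R\rangle$ with $X$ finite ($R\subseteq F$ possibly infinite) its $p$-deficiency is $\mathrm{def}_p\langle X|R\rangle=|X|-1-\sum_{r\in R}p^{-\nu_p(r)}$ (equal to $-\infty$ if the sum diverges). The $p$-deficiency $\mathrm{def}_p\,\Gamma$ of a finitely generated group $\Gamma$ is the supremum of $\mathrm{def}_p\langle X|R\rangle$ over all presentations $\langle X|R\rangle$ of $\Gamma$ with a finite generating set $X$. *)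

(* Defs.v *)
From HB Require Import structures.
From mathcomp Require Import all_boot all_order all_algebra.
From mathcomp Require Import all_classical all_reals all_analysis.

Set Implicit Arguments.
Unset Strict Implicit.
Unset Printing Implicit Defensive.

Import Order.TTheory GRing.Theory Num.Theory.
Import numFieldNormedType.Exports.
Local Open Scope classical_set_scope.
Local Open Scope ring_scope.

(* The free group on X, realised by reduced words. The letter (x, true) stands
   for x and (x, false) for x^-1. *)
Section FreeGroup.
Variable X : choiceType.
Implicit Types (a b : X * bool) (s t : seq (X * bool)).

Definition letter_inv a := (a.1, ~~ a.2).

Definition reduced s := sorted (fun a b => b != letter_inv a) s.

Definition push a s :=
  if s is b :: s' then if b == letter_inv a then s' else a :: s else [:: a].

Definition word_mul s t := foldr push t s.

Definition word_inv s := rev (map letter_inv s).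

Lemma letter_invK : involutive letter_inv.
Proof. by move=> [x b]; rewrite /letter_inv /= negbK. Qed.

Lemma push_reduced a s : reduced s -> reduced (push a s).
Proof.
case: s => [|b s] //=; case: eqP => [_|/eqP nba] rs; first exact: path_sorted rs.
by rewrite /= nba.
Qed.

Lemma pushK a s : reduced s -> push (letter_inv a) (push a s) = s.
Proof.
case: s => [|b s] /=; first by rewrite letter_invK eqxx.
case: eqP => [->|_ _] /=; last by rewrite letter_invK eqxx.
by case: s => [|c s] //= /andP[/negPf ->].
Qed.

Lemma push_invK a s : reduced s -> push a (push (letter_inv a) s) = s.
Proof. by move=> rs; rewrite -{1}[a]letter_invK pushK. Qed.

Lemma word_mul_reduced s t : reduced t -> reduced (word_mul s t).
Proof. by move=> rt; elim: s => //= a s; exact: push_reduced. Qed.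

Lemma word_mul_push a s t : reduced t ->
  word_mul (push a s) t = push a (word_mul s t).
Proof.
move=> rt; case: s => [|b s] //=; case: eqP => [->|_] //=.
by rewrite push_invK // word_mul_reduced.
Qed.

Lemma word_mulA s t u : reduced u ->
  word_mul s (word_mul t u) = word_mul (word_mul s t) u.
Proof. by move=> ru; elim: s => //= a s ->; rewrite word_mul_push. Qed.

Lemma word_muls0 s : reduced s -> word_mul s [::] = s.
Proof.
elim: s => //= a [|b s] IHs //= /andP[nba rs].
by move: (IHs rs) => /= ->; rewrite /= (negPf nba).
Qed.

Lemma word_invK : involutive word_inv.
Proof.
move=> s; rewrite /word_inv map_rev revK -map_comp map_id_in // => a _.
exact: letter_invK.
Qed.

Lemma word_inv_reduced s : reduced s -> reduced (word_inv s).
Proof.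
rewrite /reduced /word_inv rev_sorted sorted_map; apply: sub_sorted => a b.
by rewrite /= letter_invK; apply: contraNneq => ->.
Qed.

Lemma word_mulVs s : word_mul (word_inv s) s = [::].
Proof.
elim: s => // a s IHs.
rewrite /word_inv /word_mul /= rev_cons foldr_rcons /= letter_invK eqxx.
exact: IHs.
Qed.

Record free_group := FreeGroup { word_of :> seq (X * bool); _ : reduced word_of }.

HB.instance Definition _ := [isSub for word_of].
HB.instance Definition _ := [Choice of free_group by <:].

Implicit Types w : free_group.

Lemma word_ofP w : reduced w. Proof. exact: valP w. Qed.

Definition fg_one := @FreeGroup [::] isT.
Definition fg_mul w1 w2 :=
  FreeGroup (word_mul_reduced (word_of w1) (word_ofP w2)).
Definition fg_inv w := FreeGroup (word_inv_reduced (word_ofP w)).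

Lemma fg_mulA : associative fg_mul.
Proof. by move=> u v w; apply: val_inj; rewrite /= word_mulA ?word_ofP. Qed.
Lemma fg_mul1 : left_id fg_one fg_mul.
Proof. by move=> w; apply: val_inj. Qed.
Lemma fg_mul1r : right_id fg_one fg_mul.
Proof. by move=> w; apply: val_inj; rewrite /= word_muls0 ?word_ofP. Qed.
Lemma fg_mulV : left_inverse fg_one fg_inv fg_mul.
Proof. by move=> w; apply: val_inj; rewrite /= word_mulVs. Qed.
Lemma fg_mulVr : right_inverse fg_one fg_inv fg_mul.
Proof.
by move=> w; apply: val_inj; rewrite /= -{1}(word_invK (word_of w)) word_mulVs.
Qed.

HB.instance Definition _ :=
  isGroup.Build free_group fg_mulA fg_mul1 fg_mul1r fg_mulV fg_mulVr.

Definition fg_var (x : X) : free_group := @FreeGroup [:: (x, true)] isT.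

End FreeGroup.

Section FreeGroupUniversal.
Local Open Scope group_scope.
Variables (X : choiceType) (G : groupType) (f : X -> G).

Definition letter_val (a : X * bool) : G := if a.2 then f a.1 else (f a.1)^-1.

Definition fg_lift (w : free_group X) : G :=
  foldr (fun a g => letter_val a * g) 1 w.

Lemma letter_val_inv a : letter_val (letter_inv a) = (letter_val a)^-1.
Proof. by case: a => x []; rewrite /letter_val //= invgK. Qed.

Lemma fg_liftM : {morph fg_lift : u v / u * v}.
Proof.
have pushE a s : foldr (fun a g => letter_val a * g) 1 (push a s) =
    letter_val a * foldr (fun a g => letter_val a * g) 1 s.
  case: s => [|b s] //=; case: eqP => [->|] //=.
  by rewrite letter_val_inv mulVKg.
move=> [u ru] [v rv]; rewrite /fg_lift /=; elim: u {ru} => [|a u IHu] /=.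
  by rewrite mul1g.
by rewrite pushE IHu mulgA.
Qed.

HB.instance Definition _ := isMultiplicative.Build _ _ fg_lift fg_liftM.

Lemma fg_lift_var x : fg_lift (fg_var x) = f x.
Proof. exact: mulg1. Qed.

Lemma fg_lift_uniq (g : {multiplicative free_group X -> G}) :
  (forall x, g (fg_var x) = f x) -> g =1 fg_lift.
Proof.
move=> gf; have g1 : g 1 = 1.
  by apply: (mulgI (g 1)); rewrite -gmulfM !mulg1.
have gl a : g (@FreeGroup _ [:: a] isT) = letter_val a.
  case: a => x [] //; first exact: gf.
  apply: (mulgI (f x)); rewrite /letter_val /= mulgV -gf -gmulfM -g1.
  congr (g _).
  by apply: val_inj => /=; rewrite /letter_inv /= eqxx.
case=> s rs; elim: s rs => [|a s IHs] rs.
  by rewrite (_ : FreeGroup rs = 1) ?g1 //; exact: val_inj.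
have rs' : reduced s by exact: path_sorted rs.
rewrite /fg_lift /= -gl -/(fg_lift (FreeGroup rs')) -IHs -gmulfM.
congr (g _); apply: val_inj => /=.
by case: s rs {IHs rs'} => //= b s /andP[/negPf ->].
Qed.

End FreeGroupUniversal.

Section PDeficiency.
Variable p : nat.

Definition is_pval (X : choiceType) (w : free_group X) (k : nat) : Prop :=
  (exists v, w = (v ^+ (p ^ k))%g) /\
  (forall l, (exists v, w = (v ^+ (p ^ l))%g) -> (l <= k)%N).

Definition pval (X : choiceType) (w : free_group X) : nat := xget 0%N (is_pval w).

(* The trivial word is a p^k-th power for every k, so its p-valuation is
   infinite and it weighs 0; elsewhere pval is the actual maximum. *)
Definition rel_weight (R : realType) (X : choiceType) (w : free_group X) : R :=
  if w == 1%g then 0 else p%:R ^- pval w.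

Definition def_pres (R : realType) (X : finType) (S : set (free_group X)) :
    \bar R :=
  ((#|X|%:R - 1)%:E - \esum_(w in S) (rel_weight R w)%:E)%E.

Definition normal_subgroup (G : groupType) (N : set G) : Prop :=
  [/\ N 1%g, forall x y, N x -> N y -> N (x * y)%g, forall x, N x -> N (x^-1)%g
    & forall x g, N x -> N (x ^ g)%g].

Definition normal_closure (G : groupType) (S : set G) : set G :=
  \bigcap_(N in [set N | normal_subgroup N /\ S `<=` N]) N.

(* f exhibits <X | S> as a presentation of G. *)
Definition presentation (X : finType) (S : set (free_group X)) (G : groupType)
    (f : {multiplicative free_group X -> G}) : Prop :=
  range f = [set: G] /\ [set w | f w = 1%g] = normal_closure S.

Definition def_group (R : realType) (G : groupType) : \bar R :=
  ereal_sup [set d | exists (X : finType) (S : set (free_group X))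
    (f : {multiplicative free_group X -> G}),
    presentation S f /\ d = def_pres R S].

End PDeficiency.

Section PSL2.
Variable R : realType.

Record SL2 := MkSL2 { mx_of :> 'M[R]_2; _ : \det mx_of == 1 }.

HB.instance Definition _ := [isSub for mx_of].
HB.instance Definition _ := [Choice of SL2 by <:].
HB.instance Definition _ :=
  Topological.copy SL2 (@initial_topology SL2 'M[R]_2 mx_of).

Implicit Types A B : SL2.

Lemma SL2_det A : \det A = 1. Proof. exact/eqP/(valP A). Qed.

Lemma SL2_one_subproof : \det (1 : 'M[R]_2) == 1.
Proof. by rewrite det1. Qed.
Lemma SL2_mul_subproof A B : \det (mx_of A *m mx_of B) == 1.
Proof. by rewrite det_mulmx !SL2_det mulr1. Qed.
Lemma SL2_inv_subproof A : \det (invmx A) == 1.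
Proof. by rewrite det_inv SL2_det invr1. Qed.

Definition SL2_one := MkSL2 SL2_one_subproof.
Definition SL2_mul A B := MkSL2 (SL2_mul_subproof A B).
Definition SL2_inv A := MkSL2 (SL2_inv_subproof A).

Lemma SL2_unit A : mx_of A \in unitmx.
Proof. by rewrite unitmxE SL2_det unitr1. Qed.

Lemma SL2_mulA : associative SL2_mul.
Proof. by move=> A B C; apply: val_inj; exact: mulmxA. Qed.
Lemma SL2_mul1 : left_id SL2_one SL2_mul.
Proof. by move=> A; apply: val_inj; exact: mul1mx. Qed.
Lemma SL2_mul1r : right_id SL2_one SL2_mul.
Proof. by move=> A; apply: val_inj; exact: mulmx1. Qed.
Lemma SL2_mulV : left_inverse SL2_one SL2_inv SL2_mul.
Proof. by move=> A; apply: val_inj; exact: mulVmx (SL2_unit A). Qed.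
Lemma SL2_mulVr : right_inverse SL2_one SL2_inv SL2_mul.
Proof. by move=> A; apply: val_inj; exact: mulmxV (SL2_unit A). Qed.

HB.instance Definition _ :=
  isGroup.Build SL2 SL2_mulA SL2_mul1 SL2_mul1r SL2_mulV SL2_mulVr.

Definition eq_sign A B := (mx_of A == mx_of B) || (mx_of A == - mx_of B).

Lemma eq_sign_equiv : equiv_class_of eq_sign.
Proof.
split=> [A|A B|B A C]; rewrite /eq_sign ?eqxx //.
- by congr (_ || _); [exact: eq_sym | rewrite -eqr_oppLR; exact: eq_sym].
- move=> /orP[] /eqP-> /orP[] /eqP->; rewrite ?opprK eqxx ?orbT //.
Qed.

Canonical eq_sign_rel := EquivRelPack eq_sign_equiv.

Local Open Scope quotient_scope.

Definition PSL2 : Type := quotient_topology {eq_quot eq_sign}.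

HB.instance Definition _ := Choice.on PSL2.
HB.instance Definition _ := Topological.on PSL2.

Definition to_PSL2 A : PSL2 := \pi_({eq_quot eq_sign}) A.
Definition PSL2_repr (x : PSL2) : SL2 := repr (x : {eq_quot eq_sign}).

Lemma PSL2_reprK : cancel PSL2_repr to_PSL2.
Proof. exact: reprK. Qed.

Lemma to_PSL2_eqP A B : reflect (to_PSL2 A = to_PSL2 B) (eq_sign A B).
Proof. exact: (eqmodP eq_sign_rel). Qed.

Lemma eq_sign_repr A : eq_sign A (PSL2_repr (to_PSL2 A)).
Proof. by apply/to_PSL2_eqP; rewrite PSL2_reprK. Qed.

Definition PSL2_one : PSL2 := to_PSL2 1%g.
Definition PSL2_mul (x y : PSL2) : PSL2 :=
  to_PSL2 (PSL2_repr x * PSL2_repr y)%g.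
Definition PSL2_inv (x : PSL2) : PSL2 := to_PSL2 (PSL2_repr x)^-1%g.

Lemma to_PSL2_mul A B :
  to_PSL2 (A * B)%g = PSL2_mul (to_PSL2 A) (to_PSL2 B).
Proof.
apply/to_PSL2_eqP; rewrite /eq_sign /=.
case/orP: (eq_sign_repr A) => /eqP ->; case/orP: (eq_sign_repr B) => /eqP ->.
- by rewrite eqxx.
- by rewrite mulmxN eqxx orbT.
- by rewrite mulNmx eqxx orbT.
- by rewrite mulmxN mulNmx opprK eqxx.
Qed.

Lemma PSL2_mulA : associative PSL2_mul.
Proof.
move=> x y z; rewrite -[x]PSL2_reprK -[y]PSL2_reprK -[z]PSL2_reprK.
by rewrite -!to_PSL2_mul mulgA.
Qed.
Lemma PSL2_mul1 : left_id PSL2_one PSL2_mul.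
Proof. by move=> x; rewrite -[x]PSL2_reprK -to_PSL2_mul mul1g. Qed.
Lemma PSL2_mul1r : right_id PSL2_one PSL2_mul.
Proof. by move=> x; rewrite -[x]PSL2_reprK -to_PSL2_mul mulg1. Qed.
Lemma PSL2_mulV : left_inverse PSL2_one PSL2_inv PSL2_mul.
Proof. by move=> x; rewrite -{2}[x]PSL2_reprK -to_PSL2_mul mulVg. Qed.
Lemma PSL2_mulVr : right_inverse PSL2_one PSL2_inv PSL2_mul.
Proof. by move=> x; rewrite -{1}[x]PSL2_reprK -to_PSL2_mul mulgV. Qed.

HB.instance Definition _ :=
  isGroup.Build PSL2 PSL2_mulA PSL2_mul1 PSL2_mul1r PSL2_mulV PSL2_mulVr.

HB.instance Definition _ := isMultiplicative.Build SL2 PSL2 to_PSL2 to_PSL2_mul.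

Lemma open_PSL2E (U : set PSL2) : open U = open (to_PSL2 @^-1` U).
Proof. by []. Qed.

Definition abs_trace (g : PSL2) : R := `| \tr (mx_of (PSL2_repr g)) |.

Lemma abs_trace_to_PSL2 A : abs_trace (to_PSL2 A) = `| \tr (mx_of A) |.
Proof.
rewrite /abs_trace; case/orP: (eq_sign_repr A) => /eqP -> //.
by rewrite raddfN normrN.
Qed.

Definition elliptic (g : PSL2) : Prop := abs_trace g < 2.

Definition parabolic (g : PSL2) : Prop := g <> 1%g /\ abs_trace g = 2.

(* iota exhibits G as a discrete subgroup of PSL(2, R), i.e. as an
   orientation-preserving (orientable) Fuchsian group. *)
Definition fuchsian (G : groupType) (iota : {multiplicative G -> PSL2}) : Prop :=
  injective iota /\ isolated (range iota) = range iota.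

End PSL2.

Section StandardPresentation.
Variables (r s : nat) (e : 'I_r -> nat).

Definition std_gen : finType := ('I_r + ('I_s + 'I_s))%type.

Definition gen_x (i : 'I_r) : free_group std_gen := fg_var (inl i).
Definition gen_u (j : 'I_s) : free_group std_gen := fg_var (inr (inl j)).
Definition gen_v (j : 'I_s) : free_group std_gen := fg_var (inr (inr j)).

(* [~ u, v] = u^-1 v^-1 u v; the other convention amounts to replacing each
   generator u_j, v_j by its inverse. *)
Definition long_rel : free_group std_gen :=
  ((\prod_(i < r) gen_x i) * \prod_(j < s) [~ gen_u j, gen_v j])%g.

Definition std_rel : set (free_group std_gen) :=
  [set w | (exists i, w = (gen_x i ^+ e i)%g) \/ w = long_rel].

End StandardPresentation.

Arguments std_rel {r} s e _.

Definition std_condition (p r s : nat) (e : 'I_r -> nat) : Prop :=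
  [\/ (1 <= s)%N,
      [/\ (3 <= p)%N, (3 <= r)%N & forall i : 'I_r, (i < 3)%N -> (p %| e i)%N],
      [/\ p = 2%N, (4 <= r)%N & forall i : 'I_r, (i < 4)%N -> (2 %| e i)%N]
    | [/\ p = 2%N, (3 <= r)%N, forall i : 'I_r, (i < 2)%N -> (4 %| e i)%N
        & forall i : 'I_r, i = 2%N :> nat -> (2 %| e i)%N]].

(* Main.v *)
Require Import Defs.
From HB Require Import structures.
From mathcomp Require Import all_boot all_order all_algebra all_fingroup.
From mathcomp Require Import cyclic lra.
From mathcomp Require Import all_classical all_reals all_analysis.

(* Let V = F_p[G] for a finite quotient G of Gamma. Counting the derivations
   Gamma -> V gives, for every presentation <X | S> of Gamma, the bound
   |G| (def_p <X | S> + 1) <= dim Der(Gamma, V): the relator w = v^q, with q a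
   power of p, imposes the condition (1 + v + ... + v^(q-1)) D(v) = 0, and
   1 + v + ... + v^(q-1) = (v - 1)^(q-1) has rank at most |G| / q because
   (v - 1)^q = v^q - 1 = 0. For the standard presentation, if each x_i has order
   q_i = p^nu_p(e_i) in G, then F_p[G] is free over <x_i>, the ranks are exactly
   |G| / q_i, and the conditions are independent up to one dimension, whence
   def_p Gamma <= 2 s - 2 + sum_i (1 - 1 / q_i) + 1 / |G|. Under (1)-(4) such
   quotients G exist with |G| arbitrarily large. Otherwise the maximal
   p-quotient of Gamma is finite, cyclic or dihedral, and the same count over it
   gives def_p Gamma < 0. *)

Set Implicit Arguments.
Unset Strict Implicit.
Unset Printing Implicit Defensive.

Import Order.TTheory GRing.Theory Num.Theory.
Import numFieldNormedType.Exports.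
Local Open Scope ring_scope.

(** The space of derivations depends only on Gamma and V, while Fox calculus computes it from any
    presentation: a lower bound from an arbitrary, possibly infinite <X | S> can be played off
    against an upper bound from the standard one. The quotients are direct products of explicit
    ones, each separating one word: cyclic groups, and wreath products of Z/n by a cyclic group. In
    the latter, powers of (f, k) sum f along orbits of k, so an element with k nonzero can have
    small order whatever n is, whereas the quotient of two elements with the same k is a base
    element, possibly of order n. Only the orders of the images of the x_i and the size of the image
    matter, so these groups need not be p-groups. In the cyclic exceptional case x_0 may fail to
    reach order q_0; its torsion relation is then left out, which makes the long relation wholly
    independent and replaces -2 + (1 - 1/q_0) + 1/|G| by -1. *)

Section GroupMorphisms.
Local Open Scope group_scope.
Variables (G H : groupType) (f : {multiplicative G -> H}).

Lemma homg1 : f 1 = 1.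
Proof. by apply: (mulgI (f 1)); rewrite -gmulfM !mulg1. Qed.

Let h : UMagmaMorphism.type G H :=
  HB.pack (f : G -> H) (isUMagmaMorphism.Build G H f (homg1, @gmulfM _ _ f)).

Lemma homgV : {morph f : x / x^-1}.
Proof. exact: (gmulfV h). Qed.

Lemma homgX n : {morph f : x / x ^+ n}.
Proof. exact: (gmulfXn h). Qed.

Lemma homgR : {morph f : x y / [~ x, y]}.
Proof. exact: (gmulfR h). Qed.

Lemma homg_prod I (s : seq I) P (F : I -> G) :
  f (\prod_(i <- s | P i) F i) = \prod_(i <- s | P i) f (F i).
Proof. exact: (gmulf_prod h). Qed.

End GroupMorphisms.

Lemma free_group_ext (X : choiceType) (G : groupType)
    (f g : {multiplicative free_group X -> G}) :
  (forall x, f (fg_var x) = g (fg_var x)) -> f =1 g.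
Proof.
move=> eqfg w.
rewrite (@fg_lift_uniq X G (fun x => g (fg_var x)) f eqfg).
by rewrite [RHS](@fg_lift_uniq X G (fun x => g (fg_var x)) g).
Qed.

Lemma presentation_ker (X : finType) (S : set (free_group X)) (G : groupType)
    (f : {multiplicative free_group X -> G}) (N : set (free_group X)) :
  presentation S f -> normal_subgroup N -> (forall w, S w -> N w) ->
  forall w, f w = 1%g -> N w.
Proof.
case=> _ kerf nN SN w fw1.
have : normal_closure S w by rewrite -kerf.
by apply; split.
Qed.

Lemma presentation_rel (X : finType) (S : set (free_group X)) (G : groupType)
    (f : {multiplicative free_group X -> G}) w :
  presentation S f -> S w -> f w = 1%g.
Proof.
case=> _ kerf Sw; suff : [set w | f w = 1%g]%classic w by [].
by rewrite kerf => N [_]; apply.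
Qed.

(** Choosing a word over X for the image of each letter of Y; derivations will be pulled back along
    [phi]. *)
Lemma presentation_lift (X Y : finType) (S : set (free_group X)) (G : groupType)
    (f : {multiplicative free_group X -> G})
    (g : {multiplicative free_group Y -> G}) :
  presentation S f ->
  exists phi : {multiplicative free_group Y -> free_group X},
    forall w, f (phi w) = g w.
Proof.
case=> surj _.
have /choice[h hP] y : exists w, f w = g (fg_var y).
  by have : range f (g (fg_var y)) by [rewrite surj]; case=> w _ <-; exists w.
exists (fg_lift h).
by apply: (@free_group_ext _ _ (f \o fg_lift h) g) => y; rewrite /= fg_lift_var.
Qed.

(** * Derivations of free groups *)

Lemma free_group_cons (X : choiceType) x b (s : seq (X * bool))
    (rs : reduced ((x, b) :: s)) :
  FreeGroup rs = ((if b then fg_var x else (fg_var x)^-1) *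
    @FreeGroup _ s (path_sorted rs))%g.
Proof.
by apply: val_inj; case: b rs => rs; case: s rs => //= b s /andP[/negPf ->].
Qed.

Lemma free_group_gen (X : choiceType) (P : free_group X -> Prop) :
  P 1%g -> (forall x, P (fg_var x)) ->
  (forall u v, P u -> P v -> P (u * v)%g) ->
  (forall u, P u -> P u^-1%g) -> forall w, P w.
Proof.
move=> P1 Pvar PM PV [t rt]; elim: t rt => [|[x b] t IHt] rt.
  by rewrite (_ : FreeGroup rt = 1%g) //; exact: val_inj.
by rewrite free_group_cons; apply: PM => //; case: b {rt} => //; exact: PV.
Qed.

Section FoxDerivations.
Variables (K : fieldType) (V : vectType K).

(** The values lie in an algebra, not a group, so [rho 1 = id] does not follow from
    multiplicativity. *)
Definition is_rep (H : groupType) (rho : H -> 'End(V)) :=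
  rho 1%g = \1%VF /\ forall u v, rho (u * v)%g = (rho u \o rho v)%VF.

Definition is_der (H : groupType) (rho : H -> 'End(V)) (D : H -> V) :=
  forall u v, D (u * v)%g = D u + rho u (D v).

Section Derivations.
Variables (H : groupType) (rho : H -> 'End(V)) (D : H -> V).
Hypotheses (rhoP : is_rep rho) (DP : is_der rho D).

Lemma rep1 v : rho 1%g v = v.
Proof. by rewrite rhoP.1 id_lfunE. Qed.

Lemma repM u w v : rho (u * w)%g v = rho u (rho w v).
Proof. by rewrite rhoP.2 comp_lfunE. Qed.

Lemma repK u : cancel (rho u) (rho u^-1%g).
Proof. by move=> v; rewrite -repM mulVg rep1. Qed.

Lemma repVK u : cancel (rho u^-1%g) (rho u).
Proof. by move=> v; rewrite -repM mulgV rep1. Qed.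

Lemma repX u k v : rho (u ^+ k)%g v = iter k (rho u) v.
Proof. by elim: k => [|k IHk]; rewrite ?expg0 ?rep1 // expgS repM IHk. Qed.

Lemma der1 : D 1%g = 0.
Proof.
by have := DP 1%g 1%g; rewrite mulg1 rep1 -{1}[D 1%g]addr0 => /addrI.
Qed.

Lemma derV u : D (u^-1)%g = - rho u^-1%g (D u).
Proof. by apply/eqP; rewrite -addr_eq0 -DP mulVg der1. Qed.

Lemma derX u k : D (u ^+ k)%g = \sum_(i < k) iter i (rho u) (D u).
Proof.
elim: k => [|k IHk]; first by rewrite expg0 der1 big_ord0.
by rewrite expgSr DP IHk big_ord_recr /= repX.
Qed.

Lemma der_prod_eq0 (I : Type) (s : seq I) (F : I -> H) :
  (forall i, D (F i) = 0) -> D (\prod_(i <- s) F i)%g = 0.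
Proof.
move=> F0; elim: s => [|i s IHs]; first by rewrite big_nil der1.
by rewrite big_cons DP F0 add0r IHs linear0.
Qed.

Lemma der_prod1 (n : nat) (F : 'I_n -> H) (i : 'I_n) :
  (forall j, j != i -> D (F j) = 0) ->
  D (\prod_(j < n) F j)%g = rho (\prod_(j < n | (j < i)%N) F j)%g (D (F i)).
Proof.
elim: n F i => [|n IHn] F i; first by case: i.
rewrite big_ord_recl DP [in RHS]big_mkcond big_ord_recl /=.
case: (unliftP ord0 i) => [j|] -> F0; last first.
  have -> : D (\prod_(k < n) F (lift ord0 k))%g = 0.
    by apply: der_prod_eq0 => k; apply: F0; rewrite eq_sym neq_lift.
  by rewrite linear0 addr0 mul1g big1 ?rep1.
rewrite F0 ?neq_lift // add0r repM /=.
rewrite (IHn (fun k => F (lift ord0 k)) j); last first.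
  by move=> k nkj; apply: F0; rewrite (inj_eq lift_inj).
congr (rho _ (rho _ _)); rewrite big_mkcond /=.
by apply: eq_bigr => k _; rewrite /= /bump /= add1n ltnS.
Qed.

(** The contributions of [D u] and [D v] are kept apart, because derivations supported on a single
    generator will isolate each of them. *)
Lemma der_commg u v : D [~ u, v]%g =
  rho u^-1%g (rho v^-1%g (D u) - D u) +
  rho (u^-1 * v^-1)%g (rho u (D v) - D v).
Proof.
rewrite commgEl conjgE DP derV DP DP derV.
by rewrite repM !linearD !linearN /= [RHS]addrACA [LHS]addrA [LHS]addrC.
Qed.

End Derivations.

Section Fox.
Variables (X : choiceType) (rho : free_group X -> 'End(V)).
Hypothesis rhoP : is_rep rho.

(** The value on a w of the derivation extending [m], given its value [v] on w; the negative letter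
    uses D(x^-1) = - x^-1 D(x). *)
Definition fox_letter (m : X -> V) (a : X * bool) (v : V) : V :=
  if a.2 then m a.1 + rho (fg_var a.1) v
  else rho (fg_var a.1)^-1%g (v - m a.1).

Definition fox (m : X -> V) (w : free_group X) : V :=
  foldr (fox_letter m) 0 (word_of w).

(** This cancellation makes the fold over letters invariant under free reduction, which is what
    turns [fox] into a derivation. *)
Lemma fox_letterK m a : cancel (fox_letter m a) (fox_letter m (letter_inv a)).
Proof.
case: a => x [] v; rewrite /fox_letter /=; first by rewrite addrC addKr repK.
by rewrite repVK // addrC subrK.
Qed.

Lemma foldr_fox_push m a s v :
  foldr (fox_letter m) v (push a s) =
  fox_letter m a (foldr (fox_letter m) v s).
Proof.
case: s => [|b s] //=; case: eqP => [->|] //=.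
by rewrite -{1}[a]letter_invK fox_letterK.
Qed.

Lemma foldr_fox m w v : foldr (fox_letter m) v (word_of w) = fox m w + rho w v.
Proof.
rewrite /fox; case: w => s rs /=; elim: s rs => [|[x b] s IHs] rs /=.
  rewrite (_ : FreeGroup rs = 1%g) ?rep1 ?add0r //; exact: val_inj.
rewrite (IHs (path_sorted rs)) free_group_cons repM // /fox_letter /=.
move: (FreeGroup _) => w; case: b {rs} => /=; first by rewrite linearD addrA.
by rewrite -linearD addrAC.
Qed.

Lemma fox_der m : is_der rho (fox m).
Proof.
move=> u v; rewrite -foldr_fox {1}/fox /=.
by elim: (word_of u) => //= a s IHs; rewrite foldr_fox_push IHs.
Qed.

Lemma fox_var m x : fox m (fg_var x) = m x.
Proof. by rewrite /fox /= /fox_letter /= linear0 addr0. Qed.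

Lemma der_free_ext D D' : is_der rho D -> is_der rho D' ->
  (forall x, D (fg_var x) = D' (fg_var x)) -> D =1 D'.
Proof.
move=> dD dD' eqD; apply: free_group_gen => // [|u v eu ev|u eu].
- by rewrite !(der1 rhoP).
- by rewrite dD dD' eu ev.
- by rewrite !(derV rhoP) // eu.
Qed.

Lemma fox_ext D : is_der rho D -> D =1 fox (fun x => D (fg_var x)).
Proof.
move=> dD; apply: der_free_ext => // [|x]; first exact: fox_der.
by rewrite fox_var.
Qed.

(** A linear combination of derivations is a derivation, hence determined by its values on the
    generators. *)
Lemma fox_linear w k m m' :
  fox (fun x => k *: m x + m' x) w = k *: fox m w + fox m' w.
Proof.
pose D u := k *: fox m u + fox m' u.
have dD : is_der rho D.
  move=> u v; rewrite /D !fox_der !linearD linearZ /=.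
  by rewrite addrACA.
rewrite -/(D w) (fox_ext dD); congr (fox _ w).
by apply/funext => x; rewrite /D !fox_var.
Qed.

End Fox.

End FoxDerivations.

(** * Norm operators in characteristic p *)

Section NormOperator.
Variables (K : fieldType) (V : vectType K).
Implicit Types (x T : 'End(V)).

(** Powers are iterated compositions, since the ring structure used on endomorphisms requires V to
    be nonzero. *)
Definition lnorm x q : 'End(V) := \sum_(i < q) iter i (comp_lfun x) \1%VF.

Lemma iter_compE x i v : iter i (comp_lfun x) \1%VF v = iter i x v.
Proof. by elim: i => [|i IHi] /=; rewrite ?id_lfunE // comp_lfunE IHi. Qed.

Lemma lnormE x q v : lnorm x q v = \sum_(i < q) iter i x v.
Proof. by rewrite sum_lfunE; apply: eq_bigr => i _; exact: iter_compE. Qed.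

Lemma lnorm_fixed x q v : iter q x v = v -> x (lnorm x q v) = lnorm x q v.
Proof.
move=> xq; rewrite lnormE linear_sum /=.
case: q xq => [|q] xq; first by rewrite !big_ord0.
by rewrite big_ord_recr big_ord_recl /= -iterS xq addrC.
Qed.

(** In the chain V, TV, T^2 V, ..., 0, rank-nullity says that the step from T^i V to T^(i+1) V loses
    the part of T^i V inside ker T. *)
Lemma dim_nilpotent_chain T q : (forall v, iter q T v = 0) ->
  dim V = (\sum_(i < q) \dim (limg (iter i (comp_lfun T) \1%VF) :&: lker T))%N.
Proof.
move=> Tq; suff: dim V = (\sum_(i < q)
    \dim (limg (iter i (comp_lfun T) \1%VF) :&: lker T) +
    \dim (limg (iter q (comp_lfun T) \1%VF)))%N.
  move=> {1}->; rewrite (_ : limg _ = 0%VS) ?dimv0 ?addn0 //.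
  apply/eqP; rewrite -lkerE; apply/subvP => v _.
  by rewrite memv_ker iter_compE Tq.
elim: {Tq}q => [|q IHq]; first by rewrite big_ord0 /= lim1g dimvf.
by rewrite big_ord_recr /= limg_comp -addnA limg_ker_dim.
Qed.

Lemma dim_le_lker T q : (forall v, iter q T v = 0) ->
  (dim V <= q * \dim (lker T))%N.
Proof.
move=> /dim_nilpotent_chain ->.
have -> : (q * \dim (lker T) = \sum_(i < q) \dim (lker T))%N.
  by rewrite sum_nat_const card_ord.
by apply: leq_sum => i _; rewrite dimvS // capvSr.
Qed.

(** The image of T^q is killed by T and lies in every T^i V with i <= q, so it fits into each of the
    q + 1 terms of the chain. *)
Lemma dim_limg_nilpotent T q : (forall v, iter q.+1 T v = 0) ->
  (q.+1 * \dim (limg (iter q (comp_lfun T) \1%VF)) <= dim V)%N.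
Proof.
move=> Tq; set d := \dim _; have -> : (q.+1 * d = \sum_(i < q.+1) d)%N.
  by rewrite sum_nat_const card_ord.
rewrite (dim_nilpotent_chain Tq); apply: leq_sum => i _; apply: dimvS.
rewrite subv_cap; apply/andP; split; apply/subvP => _ /memv_imgP[v _ ->].
  move: (nat_of_ord i) (ltnSE (ltn_ord i)) => j jq.
  rewrite iter_compE -(subnKC jq) iterD -[iter j T _]iter_compE.
  exact/memv_img/memvf.
by rewrite memv_ker iter_compE -iterS Tq.
Qed.

Variable p : nat.
Hypothesis pK : p \in [pchar K].

(** Both claims are specialised from K[X], an integral domain: X - 1 can be cancelled there from (X
    - 1)(1 + ... + X^(q-1)) = X^q - 1 = (X - 1)^q. *)
Lemma lnorm_pchar x k : (0 < dim V)%N ->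
  lnorm x (p ^ k) = iter (p ^ k).-1 (comp_lfun (x - \1)%VF) \1%VF /\
  (forall v, iter (p ^ k) x v = v -> iter (p ^ k) (x - \1)%VF v = 0).
Proof.
move=> V0; have q0 : (0 < p ^ k)%N.
  by rewrite expn_gt0 (prime_gt0 (pcharf_prime pK)).
pose A := lfun_algType V0.
pose h : {rmorphism {poly K} -> A} := horner_alg (x : A).
have hX : h 'X = x by exact: horner_algX.
have frob : ('X - 1) ^+ (p ^ k) = 'X^(p ^ k) - 1 :> {poly K}.
  apply/eqP; rewrite eq_sym subr_eq -{2}(expr1n _ (p ^ k)).
  rewrite -exprDn_pchar ?subrK //.
  by rewrite pnatX pnatE ?(pcharf_prime pK) // pchar_poly pK.
have compE (f : A) i : iter i (comp_lfun f) \1%VF = f ^+ i :> A.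
  by elim: i => [|i IHi]; rewrite ?expr0 // exprSr /= IHi.
have geom : \sum_(i < p ^ k) 'X^i = ('X - 1) ^+ (p ^ k).-1 :> {poly K}.
  apply: (mulfI (monic_neq0 (monicXsubC 1))); rewrite polyC1.
  by rewrite -subrX1 -exprS prednK // frob.
have hX1 : h ('X - 1) = x - \1%VF by rewrite rmorphB hX rmorph1.
split=> [|v xq].
  rewrite compE -hX1 -rmorphXn -geom rmorph_sum; apply: eq_bigr => i _.
  by rewrite compE rmorphXn hX.
have := congr1 (fun f : 'End(V) => f v) (congr1 h frob).
rewrite rmorphXn hX1 rmorphB rmorph1 rmorphXn hX.
by rewrite -!compE add_lfunE opp_lfunE id_lfunE !iter_compE xq subrr => ->.
Qed.

Lemma dim_limg_lnorm x k : (forall v, iter (p ^ k) x v = v) ->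
  (p ^ k * \dim (limg (lnorm x (p ^ k))) <= dim V)%N.
Proof.
move=> xq; have [V0|V0] := posnP (dim V).
  have /eqP-> : (\dim (limg (lnorm x (p ^ k))) == 0)%N.
    by rewrite -leqn0 -V0 -dimvf dimvS ?subvf.
  by rewrite muln0.
have [-> nilp] := @lnorm_pchar x k V0.
have q0 : (0 < p ^ k)%N by rewrite expn_gt0 (prime_gt0 (pcharf_prime pK)).
rewrite -{1}(prednK q0); apply: dim_limg_nilpotent => v.
by rewrite prednK ?nilp.
Qed.

Lemma dim_lker_unipotent x k : (forall v, iter (p ^ k) x v = v) ->
  (dim V <= p ^ k * \dim (lker (x - \1%VF)%R))%N.
Proof.
move=> xq; have [->//|V0] := posnP (dim V).
by apply: dim_le_lker => v; have [_ ->] := @lnorm_pchar x k V0.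
Qed.

End NormOperator.

Section FoxLinear.
Variables (K : fieldType) (V : vectType K) (X : finType).
Variable rho : free_group X -> 'End(V).
Hypothesis rhoP : is_rep rho.

Fact fox_lin_subproof w :
  linear (fun m : {ffun X -> V} => fox rho m w : V).
Proof.
move=> k m m'; rewrite -fox_linear //; congr (fox _ _ w).
by apply/funext => x; rewrite !ffunE.
Qed.

Definition fox_lin w : {linear {ffun X -> V} -> V} :=
  HB.pack (fun m : {ffun X -> V} => fox rho m w : V)
    (GRing.isLinear.Build _ _ _ _ _ (fox_lin_subproof w)).

Definition foxL w : 'Hom({ffun X -> V}, V) := linfun (fox_lin w).

Lemma foxLE w m : foxL w m = fox rho m w.
Proof. by rewrite lfunE. Qed.

Lemma foxLX v k : foxL (v ^+ k)%g = (lnorm (rho v) k \o foxL v)%VF.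
Proof.
apply/lfunP => m; rewrite comp_lfunE !foxLE lnormE.
exact: derX (fox_der _ _) _ _.
Qed.

(* Derivations of the free group correspond to their values on X; those killing
   the relators are the derivations of the presented group. *)
Definition fox_sol (T : seq (free_group X)) : {vspace {ffun X -> V}} :=
  (\bigcap_(w <- T) lker (foxL w))%VS.

Lemma fox_solP T (m : {ffun X -> V}) :
  reflect (forall w, w \in T -> fox rho m w = 0) (m \in fox_sol T).
Proof.
apply: (iffP idP) => [+ w Tw | m0].
  by rewrite /fox_sol (big_rem w) //= memv_cap memv_ker foxLE => /andP[/eqP].
rewrite /fox_sol; elim: T m0 => [|w T IHT] m0; first by rewrite big_nil memvf.
rewrite big_cons memv_cap memv_ker foxLE m0 ?mem_head //= eqxx /=.
by apply: IHT => u Tu; apply: m0; rewrite inE Tu orbT.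
Qed.

Lemma dim_fox_sol T : (#|X| * dim V <=
  \dim (fox_sol T) + \sum_(w <- T) \dim (limg (foxL w)))%N.
Proof.
rewrite /fox_sol; elim: T => [|w T IHT].
  by rewrite !big_nil addn0 dimvf.
apply: leq_trans IHT _; rewrite !big_cons capvC.
set U := (\bigcap_(u <- T) _)%VS; rewrite -(limg_ker_dim (foxL w) U).
by rewrite addnA leq_add2r leq_add2l dimvS // limgS // subvf.
Qed.

(** Among finite subsets of S, take one whose solution space has least dimension: adjoining any
    further relator cannot shrink it. *)
Lemma fox_sol_finite (S : set (free_group X)) : exists T : seq (free_group X),
  [/\ uniq T, forall w, w \in T -> S w &
    forall m, m \in fox_sol T -> forall w, S w -> fox rho m w = 0].
Proof.
pose P d := `[< exists T : seq (free_group X),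
  [/\ uniq T, forall w, w \in T -> S w & \dim (fox_sol T) = d] >].
have exP : exists d, P d.
  by exists (\dim (fox_sol [::])); apply/asboolP; exists [::].
case: (ex_minnP exP) => d /asboolP[T [uT TS dT]] min_d; exists T; split=> // m.
move=> mT w Sw; have [Tw|nTw] := boolP (w \in T); first exact: fox_solP mT w Tw.
have sub : (fox_sol (w :: T) <= fox_sol T)%VS.
  by rewrite {1}/fox_sol big_cons capvSr.
suff /eqP eqT : fox_sol (w :: T) == fox_sol T.
  by move: mT; rewrite -eqT => /fox_solP; apply; exact: mem_head.
rewrite eqEdim sub dT; apply: min_d; apply/asboolP; exists (w :: T).
split=> //=; first by rewrite nTw.
by move=> u; rewrite inE => /orP[/eqP->|/TS].
Qed.

End FoxLinear.

(** * Comparison of two presentations *)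

Section Transfer.
Variables (K : fieldType) (V : vectType K) (Gamma : groupType).
Variables (X Y : finType) (S : set (free_group X)) (T : set (free_group Y)).
Variables (g : {multiplicative free_group X -> Gamma})
  (f : {multiplicative free_group Y -> Gamma}).
Hypotheses (gP : presentation S g) (fP : presentation T f).
Variable rho : free_group Y -> 'End(V).
Hypotheses (rhoP : is_rep rho) (rhoT : forall w, T w -> rho w = \1%VF).

Lemma rep_ker w : f w = 1%g -> rho w = \1%VF.
Proof.
pose N := [set u | rho u = \1%VF]%classic.
apply: (presentation_ker (N := N) fP) => //; have [r1 rM] := rhoP.
have NV u : N u -> N u^-1%g.
  by move=> Nu; rewrite /N /= -[LHS]comp_lfun1r -{1}Nu -rM mulVg.
split=> [|u v Nu Nv|u|u v Nu]; [exact: r1 | | exact: NV | ].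
  by rewrite /N /= rM Nu Nv comp_lfun1l.
by rewrite /N /= conjgE !rM Nu comp_lfun1l -rM mulVg.
Qed.

(** Derivations are pulled back along [phi]. Injectivity of this map on [A] is enough, since only an
    upper bound on [\dim A] will be wanted. *)
Lemma rep_transfer : exists rho' : free_group X -> 'End(V),
  [/\ is_rep rho', forall w, S w -> rho' w = \1%VF &
    forall A : {vspace {ffun X -> V}},
      (forall m, m \in A -> forall w, S w -> fox rho' m w = 0) ->
    exists2 B : {vspace {ffun Y -> V}}, \dim A = \dim B &
      forall m, m \in B -> forall w, T w -> fox rho m w = 0].
Proof.
have [phi phiE] := presentation_lift f gP.
have [psi psiE] := presentation_lift g fP.
pose rho' w := rho (psi w).
have rho'P : is_rep rho'.
  split=> [|u v]; rewrite /rho' ?homg1 ?gmulfM; first exact: rhoP.1.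
  exact: rhoP.2.
have rho'g w : g w = 1%g -> rho' w = \1%VF.
  by move=> gw; apply: rep_ker; rewrite psiE.
have rho'phi w : rho' (phi w) = rho w.
  have ker : f (psi (phi w) * w^-1)%g = 1%g.
    by rewrite gmulfM homgV psiE phiE mulgV.
  apply/lfunP => v; rewrite /rho' -[psi _](mulgKV w).
  by rewrite (repM rhoP) rep_ker ?id_lfunE.
exists rho'; split=> // [w Sw|A AS]; first exact/rho'g/(presentation_rel gP).
(* Words of the kernel act trivially, so vanishing of the derivation passes to their products and
   conjugates, hence from S to its normal closure. *)
have A_ker m : m \in A -> forall w, g w = 1%g -> fox rho' m w = 0.
  move=> mA w gw; pose N := [set u | g u = 1%g /\ fox rho' m u = 0]%classic.
  suff [] : N w by [].
  have dm := fox_der rho'P m.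
  apply: (presentation_ker (N := N) gP) => //; last first.
    by move=> u Su; split; [exact: presentation_rel Su | exact: AS].
  split=> [|u v [gu mu] [gv mv]|u [gu mu]|u v [gu mu]].
  - by split; [exact: homg1 | exact: der1 dm].
  - by split; rewrite ?gmulfM ?gu ?gv ?mulg1 // dm mu mv linear0 addr0.
  - by split; rewrite ?homgV ?gu ?invg1 // (derV rho'P dm) mu linear0 oppr0.
  - split; first by rewrite conjgE !gmulfM homgV gu mul1g mulVg.
    by rewrite conjgE !dm mu add0r (derV rho'P dm) (rho'g u) // id_lfunE addNr.
pose t m : {ffun Y -> V} := [ffun y => foxL rho'P (phi (fg_var y)) m].
have t_lin : linear t.
  by move=> k m m'; apply/ffunP => y; rewrite !ffunE linearP.
pose tL : {linear {ffun X -> V} -> {ffun Y -> V}} :=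
  HB.pack t (GRing.isLinear.Build _ _ _ _ _ t_lin).
pose Phi : 'Hom({ffun X -> V}, {ffun Y -> V}) := linfun tL.
have foxPhi m w : fox rho (Phi m) w = fox rho' m (phi w).
  have dphi : is_der rho (fun w => fox rho' m (phi w)).
    by move=> u v; rewrite gmulfM (fox_der rho'P) rho'phi.
  rewrite (fox_ext rhoP dphi); congr (fox _ _ w); apply/funext => y.
  by rewrite lfunE ffunE foxLE.
exists (Phi @: A)%VS => [|_ /memv_imgP[m mA ->] w Tw].
  rewrite limg_dim_eq //; apply/eqP; rewrite -subv0; apply/subvP => m.
  rewrite memv_cap memv_ker memv0 => /andP[mA /eqP Phi0].
  apply/eqP/ffunP => x; rewrite ffunE.
  (* x and phi (psi x) have the same image under [g], so the derivation agrees on them; on the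
     second it is a value of the derivation of [Phi m], which is 0. *)
  have := A_ker m mA (fg_var x * (phi (psi (fg_var x)))^-1)%g.
  rewrite gmulfM homgV phiE psiE mulgV => /(_ erefl).
  rewrite (fox_der rho'P) (derV rho'P (fox_der rho'P m)) -foxPhi Phi0.
  have -> : fox rho (0 : {ffun Y -> V}) (psi (fg_var x)) = 0.
    by rewrite -(foxLE rhoP) linear0.
  by rewrite !linear0 addr0 fox_var.
by rewrite foxPhi; apply: A_ker => //; rewrite phiE (presentation_rel fP).
Qed.

End Transfer.

(** * Upper bounds for the deficiency from dimensions of derivation spaces *)

Section DeficiencyBound.
Variables (R : realType) (p : nat) (K : fieldType) (V : vectType K).
Hypotheses (pK : p \in [pchar K]) (V0 : (0 < dim V)%N).

(* If w is a p^k-th power for every k, then pval p w is the junk value 0 and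
   v = w works. *)
Lemma pval_root (X : choiceType) (w : free_group X) :
  exists v, w = (v ^+ (p ^ Defs.pval p w))%g.
Proof.
rewrite /Defs.pval; case: xgetP => [k _ [] //|_].
by exists w; rewrite expn0 expg1.
Qed.

Lemma rel_weight_ge0 (X : choiceType) (w : free_group X) :
  0 <= rel_weight p R w.
Proof.
by rewrite /rel_weight; case: ifP => // _; rewrite invr_ge0 exprn_ge0.
Qed.

Lemma dim_limg_foxL (X : finType) (rho : free_group X -> 'End(V))
    (rhoP : is_rep rho) w : rho w = \1%VF ->
  (\dim (limg (foxL rhoP w)))%:R <= (dim V)%:R * rel_weight p R w.
Proof.
move=> rw; rewrite /rel_weight; case: eqP => [->|_].
  have -> : foxL rhoP 1%g = 0.
    by apply/lfunP => m; rewrite foxLE.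
  by rewrite lim0g dimv0 mulr0.
have [v wv] := pval_root w; have p0 := prime_gt0 (pcharf_prime pK).
set k := Defs.pval p w in wv *.
have vk u : iter (p ^ k) (rho v) u = u by rewrite -repX // -wv rw id_lfunE.
rewrite ler_pdivlMr ?exprn_gt0 ?ltr0n // -natrX -natrM ler_nat mulnC.
apply: leq_trans (dim_limg_lnorm pK vk).
rewrite leq_mul2l {1}wv foxLX; apply/orP; right.
by rewrite limg_comp dimvS // limgS // subvf.
Qed.

Lemma def_pres_le (X : finType) (S : set (free_group X))
    (rho : free_group X -> 'End(V)) (rhoP : is_rep rho) (b : R) :
  (forall w, S w -> rho w = \1%VF) ->
  (forall A : {vspace {ffun X -> V}},
     (forall m, m \in A -> forall w, S w -> fox rho m w = 0) ->
     (\dim A)%:R <= b * (dim V)%:R) ->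
  (def_pres p R S <= (b - 1)%:E)%E.
Proof.
move=> rhoS dimA; have [T [uT TS solT]] := fox_sol_finite rhoP S.
have := dim_fox_sol rhoP T; rewrite -(ler_nat R) natrD natr_sum natrM => le1.
have le2 : (#|X|%:R * (dim V)%:R : R) <=
    b * (dim V)%:R + (dim V)%:R * \sum_(w <- T) rel_weight p R w.
  apply: le_trans le1 _; apply: lerD; first exact: dimA.
  rewrite mulr_sumr big_seq [leRHS]big_seq; apply: ler_sum => w /TS /rhoS rw.
  exact: dim_limg_foxL.
have V0R : (0 : R) < (dim V)%:R by rewrite ltr0n.
have le3 : (#|X|%:R : R) <= b + \sum_(w <- T) rel_weight p R w.
  by rewrite -(ler_pM2r V0R) mulrDl [X in _ + X]mulrC.
have : ((\sum_(w <- T) rel_weight p R w)%:E <=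
    \esum_(w in S) (rel_weight p R w)%:E)%E.
  apply: esum_ge; exists [set` T]%classic.
    by split; [exact: finite_seq | move=> w /= /TS].
  by rewrite -fsbig_seq // sumEFin.
(* If the weights diverge, the deficiency is -oo and the bound is trivial. *)
rewrite /def_pres; case: (esum _ _) => [t| |] //=; rewrite ?leNye //.
rewrite !lee_fin => le4; lra.
Qed.

Lemma def_group_le (Gamma : groupType) (Y : finType) (T : set (free_group Y))
    (f : {multiplicative free_group Y -> Gamma})
    (rho : free_group Y -> 'End(V)) (b : R) :
  presentation T f -> is_rep rho -> (forall w, T w -> rho w = \1%VF) ->
  (forall B : {vspace {ffun Y -> V}},
     (forall m, m \in B -> forall w, T w -> fox rho m w = 0) ->
     (\dim B)%:R <= b * (dim V)%:R) ->
  (def_group p R Gamma <= (b - 1)%:E)%E.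
Proof.
move=> fP rhoP rhoT dimB; apply: ge_ereal_sup => _ [X [S [g [gP ->]]]].
have [rho' [rho'P rho'S dimA]] := rep_transfer gP fP rhoP rhoT.
apply: (def_pres_le rho'P rho'S) => A /dimA[B -> BT]; exact: dimB.
Qed.

End DeficiencyBound.

(** * The regular representation *)

Section RegularRepresentation.
Variables (K : fieldType) (G : finGroupType).
Let V := {ffun G -> K^o}.

Fact reg_subproof (g : G) : linear (fun f : V => [ffun t => f (t * g)%g] : V).
Proof. by move=> k f f'; apply/ffunP => t; rewrite !ffunE. Qed.

Definition reg_lin (g : G) : {linear V -> V} :=
  HB.pack (fun f : V => [ffun t => f (t * g)%g] : V)
    (GRing.isLinear.Build _ _ _ _ _ (reg_subproof g)).

Definition reg (g : G) : 'End(V) := linfun (reg_lin g).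

Lemma regE g f t : reg g f t = f (t * g)%g.
Proof. by rewrite lfunE ffunE. Qed.

Lemma reg_rep (H : groupType) (h : {multiplicative H -> G}) :
  is_rep (fun w => reg (h w)).
Proof.
split=> [|u v]; apply/lfunP => f; apply/ffunP => t.
  by rewrite regE homg1 mulg1 id_lfunE.
by rewrite comp_lfunE !regE gmulfM mulgA.
Qed.

Lemma dim_reg : dim V = #|G|.
Proof. by rewrite [LHS]muln1. Qed.

Lemma reg_iter g i f t : iter i (reg g) f t = f (t * g ^+ i)%g.
Proof.
elim: i t => [|i IHi] t; first by rewrite expg0 mulg1.
by rewrite iterS regE IHi expgS mulgA.
Qed.

Lemma reg_iter_order g q f : (g ^+ q = 1)%g -> iter q (reg g) f = f.
Proof. by move=> gq; apply/ffunP => t; rewrite reg_iter gq mulg1. Qed.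

(** K[G] is free over <g>: a function fixed by g is constant on the cosets t<g>, so it is the norm
    of its restriction to a transversal. *)
Lemma lker_reg_sub g :
  (lker (reg g - \1%VF)%R <= limg (lnorm (reg g) #[g]%g))%VS.
Proof.
apply/subvP => f; rewrite memv_ker add_lfunE opp_lfunE id_lfunE subr_eq0.
move=> /eqP fg; have fi t i : f (t * g ^+ i)%g = f t.
  by rewrite -reg_iter; elim: i => //= i IHi; rewrite -iterS iterSr fg.
pose r t := repr (t *: <[g]>)%g.
pose f1 : V := [ffun t => if r t == t then f t else 0].
suff -> : f = lnorm (reg g) #[g]%g f1 by apply/memv_img/memvf.
apply/ffunP => t; rewrite lnormE sum_ffunE.
have rr i : r (t * g ^+ i)%g = r t.
  congr repr; apply/lcoset_eqP.
  by rewrite mem_lcoset mulKg mem_cycle.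
(* The orbit of t meets the transversal at exactly one exponent j below the order of g, so a single
   term of the norm survives. *)
have /lcosetP[c /cyclePmin[j ltj ->] rt] : r t \in (t *: <[g]>)%g.
  exact: mem_repr (lcoset_refl _ t).
rewrite (bigD1 (Ordinal ltj)) //= big1 ?addr0 => [|i nij].
  by rewrite reg_iter ffunE rr rt eqxx fi.
rewrite reg_iter ffunE rr rt (inj_eq (mulgI t)); case: eqP => // eq_ij.
case/eqP: nij; apply: val_inj => /=; apply/eqP.
by move/eqP: eq_ij; rewrite eq_sym eq_expg_mod_order !modn_small.
Qed.

Lemma dim_limg_lnorm_reg p k g : p \in [pchar K] -> #[g]%g = (p ^ k)%N ->
  (#|G| <= p ^ k * \dim (limg (lnorm (reg g) (p ^ k))))%N.
Proof.
move=> pK og; rewrite -{1}dim_reg.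
apply: (leq_trans (dim_lker_unipotent (x := reg g) (k := k) pK _)).
  by move=> f; rewrite reg_iter_order // -og expg_order.
by rewrite leq_mul2l -og dimvS ?orbT // lker_reg_sub.
Qed.

Definition range_set (H : groupType) (h : H -> G) : {set G} :=
  [set g | `[< exists w, h w = g >]].

Lemma range_setP (H : groupType) (h : H -> G) g :
  reflect (exists w, h w = g) (g \in range_set h).
Proof. by rewrite inE; exact: asboolP. Qed.

Lemma group_set_range (H : groupType) (h : {multiplicative H -> G}) :
  group_set (range_set h).
Proof.
apply/group_setP; split=> [|_ _ /range_setP[u <-] /range_setP[v <-]].
  by apply/range_setP; exists 1%g; exact: homg1.
by apply/range_setP; exists (u * v)%g; exact: gmulfM.
Qed.

Canonical range_group (H : groupType) (h : {multiplicative H -> G}) :=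
  group (group_set_range h).

Lemma mem_range_set (H : groupType) (h : {multiplicative H -> G}) w :
  h w \in range_set h.
Proof. by apply/range_setP; exists w. Qed.

(** Modulo U, the delta functions of two points in the same left coset of the image of h agree, so
    V/U is spanned by one vector per coset. The index is cleared by multiplying by the order of the
    image. *)
Lemma dim_coinvariants (H : groupType) (h : {multiplicative H -> G})
    (U : {vspace V}) :
  (forall w f, reg (h w) f - f \in U) ->
  (#|range_set h| * #|G| <= #|range_set h| * \dim U + #|G|)%N.
Proof.
move=> hU; pose d (t : G) : V := [ffun s => (s == t)%:R].
have dE w t : reg (h w) (d t) = d (t * (h w)^-1)%g.
  by apply/ffunP => s; rewrite regE !ffunE (canF_eq (mulgK (h w))).
pose C := lcosets (range_set h) [set: G].
pose W := (U + \sum_(A in C) <[d (repr A)]>)%VS.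
have full : (fullv <= W)%VS.
  apply/subvP => f _; suff -> : f = \sum_t f t *: d t.
    apply: memv_suml => t _; apply: memvZ.
    have tA : t \in (t *: range_set h)%g := lcoset_refl (range_group h) t.
    have /lcosetP[_ /range_setP[w <-] rE] := mem_repr t tA.
    rewrite -[d t](subrK (d (t * h w)%g)); apply: memv_add; last first.
      rewrite -rE memvE.
      apply: (sumv_sup (t *: range_set h)%g); last exact: subvv.
      by apply/lcosetsP; exists t; rewrite ?inE.
    have -> : d t = reg (h w) (d (t * h w)%g) by rewrite dE mulgK.
    exact: hU.
  apply/ffunP => s; rewrite sum_ffunE (bigD1 s) //= big1 ?addr0 => [|t ns].
    by rewrite !ffunE eqxx [RHS]mulr1.
  by rewrite !ffunE eq_sym (negPf ns) [LHS]mulr0.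
have dimW : (#|G| <= \dim U + #|C|)%N.
  rewrite -dim_reg -dimvf; apply: leq_trans (dimvS full) _.
  apply: leq_trans (leq_of_leqif (dimv_add_leqif _ _)) _; rewrite leq_add2l.
  apply: leq_trans (dimv_leq_sum _ _ _) _; rewrite -sum1_card.
  by apply: leq_sum => A _; rewrite dim_vline leq_b1.
rewrite (leq_trans (leq_mul (leqnn _) dimW)) // mulnDr leq_add2l.
have := LagrangeI [set: G]%G (range_group h).
by rewrite finset.setTI cardsT /C card_lcosets => ->.
Qed.

End RegularRepresentation.

(** * Derivations for the standard presentation *)

(** Reduces the norm for e_i to the norm for its p-part q_i; the cofactor e_i / q_i is invertible in
    characteristic p. *)
Lemma lnorm_mul (K : fieldType) (V : vectType K) (x : 'End(V)) q n v :
  (forall u, iter q x u = u) -> lnorm x (n * q) v = n%:R *: lnorm x q v.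
Proof.
move=> xq; rewrite !lnormE; elim: n => [|n IHn].
  by rewrite mul0n big_ord0 scale0r.
have xnq u : iter (n * q) x u = u.
  by elim: {IHn}n => //= n IHn; rewrite mulSn iterD IHn xq.
rewrite mulSnr big_split_ord /= IHn -natr1 scalerDl scale1r; congr (_ + _).
by apply: eq_bigr => i _; rewrite addnC iterD xnq.
Qed.

Section DeltaFunctions.
Variables (K : fieldType) (V : vectType K) (X : finType).

Definition ffun_delta (x : X) (v : V) : {ffun X -> V} :=
  [ffun y => if y == x then v else 0].

Fact eval_subproof (x : X) : linear (fun m : {ffun X -> V} => m x : V).
Proof. by move=> k m m'; rewrite !ffunE. Qed.

Definition eval_lin (x : X) : {linear {ffun X -> V} -> V} :=
  HB.pack (fun m : {ffun X -> V} => m x : V)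
    (GRing.isLinear.Build _ _ _ _ _ (eval_subproof x)).

Definition evalL (x : X) : 'Hom({ffun X -> V}, V) := linfun (eval_lin x).

Lemma evalLE x m : evalL x m = m x.
Proof. by rewrite lfunE. Qed.

(** Conditions on distinct coordinates are independent: a vector concentrated at [x i] satisfies all
    the others while [N i] still takes every value of its image on it. *)
Lemma dim_bigcap_eval (I : eqType) (s : seq I) (x : I -> X) (N : I -> 'End(V)) :
  injective x -> uniq s ->
  (\dim (\bigcap_(i <- s) lker (N i \o evalL (x i))) +
   \sum_(i <- s) \dim (limg (N i)) <= #|X| * dim V)%N.
Proof.
move=> injx; elim: s => [|i s IHs] /=; first by rewrite !big_nil addn0 dimvf.
move=> /andP[nis us]; apply: leq_trans (IHs us); rewrite !big_cons capvC.
set Z := (\bigcap_(j <- s) _)%VS.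
rewrite addnA leq_add2r -(limg_ker_dim (N i \o evalL (x i)) Z) leq_add2l.
apply/dimvS/subvP => _ /memv_imgP[v _ ->].
have -> : N i v = (N i \o evalL (x i))%VF (ffun_delta (x i) v).
  by rewrite comp_lfunE evalLE ffunE eqxx.
apply: memv_img; rewrite /Z big_seq.
elim/big_rec: _ => [|j W js]; first exact: memvf.
rewrite memv_cap => ->; rewrite andbT memv_ker comp_lfunE evalLE ffunE.
rewrite (inj_eq injx); case: (j =P i) => [ji|_]; last by rewrite linear0.
by rewrite ji (negPf nis) in js.
Qed.

End DeltaFunctions.

Section StandardSolutions.
Variables (K : fieldType) (V : vectType K) (r s : nat).
Variables (rho : free_group (std_gen r s) -> 'End(V)) (N : 'I_r -> 'End(V)).
Hypothesis rhoP : is_rep rho.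

(** [N i] will be the norm operator of x_i, or 0 when the relation x_i^e_i is left out of the
    count. *)
Definition torsion_sol : {vspace {ffun std_gen r s -> V}} :=
  (\bigcap_(i <- enum 'I_r) lker (N i \o evalL V (inl i : std_gen r s)))%VS.

Definition long_image : {vspace V} :=
  (foxL rhoP (long_rel r s) @: torsion_sol)%VS.

Lemma torsion_solP (m : {ffun std_gen r s -> V}) :
  (forall i, N i (m (inl i)) = 0) -> m \in torsion_sol.
Proof.
move=> Nm; rewrite /torsion_sol.
elim/big_rec: _ => [|i W _]; first exact: memvf.
by rewrite memv_cap memv_ker comp_lfunE evalLE Nm eqxx.
Qed.

Lemma dim_std_sol (B : {vspace {ffun std_gen r s -> V}}) :
  (forall m, m \in B ->
     (forall i, N i (m (inl i)) = 0) /\ fox rho m (long_rel r s) = 0) ->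
  (\dim B + \dim long_image + \sum_(i < r) \dim (limg (N i)) <=
   (r + 2 * s) * dim V)%N.
Proof.
move=> BP; have inj_inl : injective (fun i : 'I_r => inl i : std_gen r s).
  by move=> i j [].
have := dim_bigcap_eval N inj_inl (enum_uniq 'I_r); rewrite -/torsion_sol.
rewrite !card_sum !card_ord addnn -mul2n big_enum /=; apply: leq_trans.
rewrite leq_add2r -(limg_ker_dim (foxL rhoP (long_rel r s)) torsion_sol).
rewrite leq_add2r; apply/dimvS/subvP => m /BP[Nm Lm].
by rewrite memv_cap torsion_solP // memv_ker foxLE Lm eqxx.
Qed.

Lemma fox_comm_eq0 (m : {ffun std_gen r s -> V}) j :
  m (inr (inl j)) = 0 -> m (inr (inr j)) = 0 ->
  fox rho m [~ gen_u r j, gen_v r j]%g = 0.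
Proof.
move=> u0 v0; rewrite (der_commg rhoP (fox_der rhoP m)) !fox_var // u0 v0.
by rewrite !(linear0, subr0, addr0).
Qed.

Let prefix_x (i : 'I_r) := (\prod_(j < r | (j < i)%N) gen_x s j)%g.

Lemma fox_long_x i v :
  fox rho (ffun_delta (inl i) v) (long_rel r s) = rho (prefix_x i) v.
Proof.
have d := fox_der rhoP (ffun_delta (inl i) v).
rewrite d [X in rho _ X](der_prod_eq0 rhoP d) ?linear0 ?addr0; last first.
  by move=> j; rewrite fox_comm_eq0 // ffunE.
rewrite (der_prod1 rhoP d (i := i)) => [|j nji].
  by rewrite fox_var // ffunE eqxx.
by rewrite fox_var // ffunE (inj_eq (@inl_inj _ _)) (negPf nji).
Qed.

(** The long relator starts with x_0, so a derivation supported on an unconstrained x_0 gives it an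
    arbitrary value. *)
Lemma long_image_full (i : 'I_r) :
  i = 0%N :> nat -> N i = 0 -> long_image = fullv.
Proof.
move=> i0 Ni; apply/eqP; rewrite eqEsubv subvf; apply/subvP => v _.
have -> : v = foxL rhoP (long_rel r s) (ffun_delta (inl i) v).
  rewrite foxLE fox_long_x /prefix_x big_pred0 ?(rep1 rhoP) // => j.
  by rewrite i0.
apply/memv_img/torsion_solP => j; rewrite ffunE (inj_eq (@inl_inj _ _)).
by case: eqP => [->|_]; rewrite ?Ni ?lfunE ?linear0.
Qed.

Definition trivial_mod (U : {vspace V}) w := forall v, rho w v - v \in U.

Lemma trivial_modM U w w' : trivial_mod U w -> trivial_mod U w' ->
  trivial_mod U (w * w')%g.
Proof.
move=> Uw Uw' v; rewrite (repM rhoP).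
by rewrite -(subrK (rho w' v) (rho w _)) -addrA memvD.
Qed.

Lemma trivial_modV U w : trivial_mod U w -> trivial_mod U w^-1%g.
Proof.
by move=> Uw v; rewrite -memvN opprB -{1}(repVK rhoP w v).
Qed.

Lemma trivial_mod1 U : trivial_mod U 1%g.
Proof. by move=> v; rewrite (rep1 rhoP) subrr mem0v. Qed.

Lemma trivial_mod_prod U (I : finType) (P : pred I) (F : I -> _) :
  (forall i, P i -> trivial_mod U (F i)) ->
  trivial_mod U (\prod_(i | P i) F i)%g.
Proof.
move=> UF; elim/big_rec: _ => [|i w Pi Uw]; first exact: trivial_mod1.
by apply: trivial_modM => //; exact: UF.
Qed.

Lemma trivial_mod_mem U w v : trivial_mod U w -> rho w v \in U -> v \in U.
Proof. by move=> Uw Uv; rewrite -[v](subKr (rho w v)) memvB. Qed.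

Lemma trivial_mod_gen U :
  (forall x, trivial_mod U (fg_var x)) -> forall w, trivial_mod U w.
Proof.
move=> Ux; apply: free_group_gen => //.
- exact: trivial_mod1.
- exact: trivial_modM.
- exact: trivial_modV.
Qed.

Hypothesis N_sub : forall i v, N i (rho (gen_x s i) v - v) = 0.

(** By [N_sub], putting (x_i - 1) v at x_i gives a torsion solution. The long relator sends it to
    (x_0 ... x_(i-1)) (x_i - 1) v, and the prefix is already trivial modulo the image by
    induction. *)
Lemma trivial_mod_x i : trivial_mod long_image (gen_x s i).
Proof.
have [n] := ubnP i; elim: n i => // n IHn i lti v.
have Up : trivial_mod long_image (prefix_x i).
  apply: trivial_mod_prod => j ltj; apply: IHn.
  exact: leq_trans ltj (ltnSE lti).
apply: (trivial_mod_mem Up); rewrite -fox_long_x -(foxLE rhoP).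
apply/memv_img/torsion_solP => j; rewrite ffunE (inj_eq (@inl_inj _ _)).
by case: eqP => [->|_]; rewrite ?N_sub ?linear0.
Qed.

Let prefix_c (i : 'I_s) :=
  (\prod_(j < s | (j < i)%N) [~ gen_u r j, gen_v r j])%g.

Lemma fox_long_c (j : 'I_s) (m : {ffun std_gen r s -> V}) :
  (forall i, m (inl i) = 0) ->
  (forall k, k != j -> m (inr (inl k)) = 0 /\ m (inr (inr k)) = 0) ->
  fox rho m (long_rel r s) =
  rho (\prod_(i < r) gen_x s i)%g (rho (prefix_c j)
    (fox rho m [~ gen_u r j, gen_v r j]%g)).
Proof.
move=> mx mc; have d := fox_der rhoP m.
rewrite d (der_prod_eq0 rhoP d) ?add0r => [|i]; last by rewrite fox_var // mx.
congr (rho _ _); apply: (der_prod1 rhoP d) => k nkj.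
by have [? ?] := mc k nkj; exact: fox_comm_eq0.
Qed.

Lemma trivial_mod_uv j : trivial_mod long_image (gen_u r j) /\
  trivial_mod long_image (gen_v r j).
Proof.
have [n] := ubnP j; elim: n j => // n IHn j ltj.
have Up : trivial_mod long_image (\prod_(i < r) gen_x s i * prefix_c j)%g.
  apply: trivial_modM; apply: trivial_mod_prod => k ltk.
    exact: trivial_mod_x.
  have [|Uu Uv] := IHn k; first exact: leq_trans ltk (ltnSE ltj).
  rewrite commgEl conjgE; apply: trivial_modM; first exact: trivial_modV.
  by apply: trivial_modM; [exact: trivial_modV | exact: trivial_modM].
have Uc (m : {ffun std_gen r s -> V}) : (forall i, m (inl i) = 0) ->
    (forall k, k != j -> m (inr (inl k)) = 0 /\ m (inr (inr k)) = 0) ->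
    fox rho m [~ gen_u r j, gen_v r j]%g \in long_image.
  move=> mx mc; apply: (trivial_mod_mem Up); rewrite (repM rhoP).
  rewrite -fox_long_c // -(foxLE rhoP); apply/memv_img/torsion_solP => i.
  by rewrite mx linear0.
set u := gen_u r j; set v := gen_v r j.
have Ua y : rho u^-1%g (rho v^-1%g y - y) \in long_image.
  have := Uc (ffun_delta (inr (inl j)) y); rewrite (der_commg rhoP) ?fox_var //.
    rewrite !ffunE eqxx /= linear0 subr0 linear0 addr0; apply=> [i|k nk].
      by rewrite ffunE.
    rewrite !ffunE /=; split=> //.
    by case: eqP => // -[/eqP]; rewrite (negPf nk).
  exact: fox_der.
have Ub y : rho u^-1%g (rho v^-1%g (rho u y - y)) \in long_image.
  have := Uc (ffun_delta (inr (inr j)) y); rewrite (der_commg rhoP) ?fox_var //.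
    rewrite !ffunE eqxx /= linear0 subr0 linear0 add0r (repM rhoP).
    apply=> [i|k nk]; first by rewrite ffunE.
    rewrite !ffunE /=; split=> //.
    by case: eqP => // -[/eqP]; rewrite (negPf nk).
  exact: fox_der.
(* With z = (u - 1) y, [Ua] at z contains u^-1 v^-1 z - u^-1 z and [Ub] at y contains u^-1 v^-1 z;
   the difference eliminates v and leaves u^-1 y - y. *)
have Uu : trivial_mod long_image u.
  rewrite -[u]invgK; apply: trivial_modV => y.
  have := memvB (Ua (rho u y - y)) (Ub y).
  by rewrite linearB /= addrC addKr linearB /= (repK rhoP) opprB.
split=> //; rewrite -[v]invgK; apply: trivial_modV => y.
exact: trivial_mod_mem (trivial_modV Uu) (Ua y).
Qed.

(* A linear functional killing long_image is therefore Gamma-invariant, so that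
   the long relation is nearly independent of the torsion relations. *)
Lemma long_image_trivial w : trivial_mod long_image w.
Proof.
apply: trivial_mod_gen => -[i|[j|j]]; first exact: trivial_mod_x.
  by case: (trivial_mod_uv j).
by case: (trivial_mod_uv j).
Qed.

End StandardSolutions.

(** * Deficiency bounds from a finite quotient of the standard presentation *)

Section StandardBound.
Variables (R : realType) (p : nat) (r s : nat) (e : 'I_r -> nat).
Hypotheses (p_prime : prime p) (e_gt0 : forall i, (0 < e i)%N).
Variables (Gamma : groupType)
  (f : {multiplicative free_group (std_gen r s) -> Gamma}).
Hypothesis fP : presentation (std_rel s e) f.
Variables (G : finGroupType)
  (h : {multiplicative free_group (std_gen r s) -> G}).
Hypothesis hP : forall w, std_rel s e w -> h w = 1%g.
Variable J : pred 'I_r.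
Hypothesis hJ : forall i, J i -> #[h (gen_x s i)]%g = (p ^ logn p (e i))%N.

Let K := 'F_p.
Let V := {ffun G -> K^o}.
Let rho w := reg K (h w).
Let rhoP : is_rep rho := reg_rep K h.
Let q i := (p ^ logn p (e i))%N.
Let N i : 'End(V) := if J i then lnorm (rho (gen_x s i)) (q i) else 0.

Let pK : p \in [pchar K]. Proof. exact: pchar_Fp. Qed.

Let dimV : dim V = #|G|. Proof. exact: dim_reg. Qed.

Let rhoX i : J i -> forall v, iter (q i) (rho (gen_x s i)) v = v.
Proof.
by move=> Ji v; apply: reg_iter_order; rewrite /q -(hJ Ji) expg_order.
Qed.

Lemma std_sol_torsion (m : {ffun std_gen r s -> V}) :
  (forall w, std_rel s e w -> fox rho m w = 0) -> forall i, N i (m (inl i)) = 0.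
Proof.
move=> mS i; rewrite /N; case: ifP => [Ji|_]; last by rewrite lfunE.
have := mS (gen_x s i ^+ e i)%g (or_introl (ex_intro _ i erefl)).
rewrite (derX rhoP (fox_der rhoP m)) -lnormE fox_var //.
rewrite -(partnC p (e_gt0 i)) p_part mulnC lnorm_mul; last exact: rhoX.
move/eqP; rewrite scaler_eq0 => /orP[|/eqP//].
rewrite -(dvdn_pcharf pK) => dvd_p.
have /(pnatP _ (part_gt0 _ _))/(_ p p_prime dvd_p) := part_pnat p^' (e i).
by rewrite !inE eqxx.
Qed.

Let dim_sol (B : {vspace {ffun std_gen r s -> V}}) :
  (forall m, m \in B -> forall w, std_rel s e w -> fox rho m w = 0) ->
  (\dim B)%:R + (\dim (long_image N rhoP))%:R <=
  ((r + 2 * s)%:R - \sum_(i < r | J i) (q i)%:R^-1) * #|G|%:R :> R.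
Proof.
move=> BS; rewrite mulrBl lerBrDr mulr_suml.
have /(dim_std_sol rhoP) : forall m, m \in B ->
    (forall i, N i (m (inl i)) = 0) /\ fox rho m (long_rel r s) = 0.
  move=> m mB; split=> [i|]; first exact/std_sol_torsion/BS.
  by apply: BS => //; right.
rewrite -(ler_nat R) natrM dimV !natrD natr_sum; apply: le_trans.
rewrite lerD2l big_mkcond /=; apply: ler_sum => i _; rewrite /N.
case: ifP => Ji; last exact: ler0n.
rewrite mulrC ler_pdivrMr ?ltr0n ?expn_gt0 ?prime_gt0 // -natrM ler_nat mulnC.
by apply: dim_limg_lnorm_reg => //; exact: hJ.
Qed.

Let sum_q : \sum_(i < r | J i) (q i)%:R^-1 =
  \sum_(i < r | J i) p%:R ^- logn p (e i) :> R.
Proof. by apply: eq_bigr => i _; rewrite /q natrX. Qed.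

Lemma def_group_le_full : (forall i, J i) ->
  (def_group p R Gamma <= (2 * s%:R - 2 +
    \sum_(i < r) (1 - p%:R ^- logn p (e i)) + #|range_set h|%:R^-1)%:E)%E.
Proof.
move=> allJ; have G0 : (0 < dim V)%N by rewrite dimV (cardD1 1%g) inE.
have H0 : (0 < #|range_set h|)%N by exact: (cardG_gt0 (range_group h)).
set b := (X in (_ <= X%:E)%E); rewrite -[b](addrK 1).
apply: (def_group_le (R := R) pK G0 fP rhoP) => [w /hP hw|B BS].
  by rewrite /rho hw -(homg1 h) (reg_rep K h).1.
have := dim_sol BS; set U := long_image _ _.
have /(dim_coinvariants (h := h)) : forall w v, rho w v - v \in U.
  apply: long_image_trivial => i v; rewrite /N allJ linearB /=; apply/eqP.
  rewrite subr_eq0 -[X in _ == X](lnorm_fixed (rhoX (allJ i) v)).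
  by rewrite !lnormE linear_sum /=; apply/eqP/eq_bigr => k _; rewrite -iterSr.
rewrite dimV -(ler_nat R) natrD !natrM => leU leB.
have {}leU : (#|G|%:R : R) <= (\dim U)%:R + #|range_set h|%:R^-1 * #|G|%:R.
  have H0R : (0 : R) < #|range_set h|%:R by rewrite ltr0n.
  by rewrite -(ler_pM2l H0R) mulrDr mulVKf ?gt_eqF.
have -> : b + 1 = (r + 2 * s)%:R - \sum_(i < r | J i) (q i)%:R^-1 - 1 +
    #|range_set h|%:R^-1.
  rewrite sum_q (eq_bigl _ _ allJ) /b sumrB sumr_const card_ord natrD natrM.
  by set S := \sum_(i < r) _; lra.
by move: leB leU; rewrite !mulrDl mulN1r; lra.
Qed.

(** Nothing is asked of the order of h(x_0): the relation x_0^e_0 is not counted, and in exchange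
    the long relation has full rank |G|. *)
Lemma def_group_le_drop (i0 : 'I_r) : i0 = 0%N :> nat ->
  (forall i, J i = (i != i0)) ->
  (def_group p R Gamma <= (2 * s%:R - 1 +
    \sum_(i < r | i != i0) (1 - p%:R ^- logn p (e i)))%:E)%E.
Proof.
move=> i00 J0; have G0 : (0 < dim V)%N by rewrite dimV (cardD1 1%g) inE.
set b := (X in (_ <= X%:E)%E); rewrite -[b](addrK 1).
apply: (def_group_le (R := R) pK G0 fP rhoP) => [w /hP hw|B BS].
  by rewrite /rho hw -(homg1 h) (reg_rep K h).1.
have := dim_sol BS; rewrite (long_image_full rhoP i00) ?dimvf ?dimV; last first.
  by rewrite /N J0 eqxx.
rewrite -lerBrDr -[X in _ - X]mul1r -mulrBl => leB; apply: le_trans leB _.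
rewrite ler_wpM2r // sum_q (eq_bigl _ _ J0) /b natrD natrM sumrB sumr_const.
have -> : #|[pred i | i != i0]| = r.-1.
  by have := cardC1 i0; rewrite card_ord => <-; apply: eq_card.
have -> : (r%:R : R) = r.-1%:R + 1.
  by rewrite natr1 prednK // (leq_ltn_trans _ (ltn_ord i0)).
by set S := \sum_(i < r | _) _; lra.
Qed.

End StandardBound.

(** * Finite quotients *)

Section WreathPermutations.
Variables A B : finZmodType.
Implicit Types (f g : B -> A) (k l : B).

Definition shift_twist f k (t : A * B) : A * B := (t.1 + f t.2, t.2 + k).

Lemma shift_twist_inj f k : injective (shift_twist f k).
Proof.
case=> [a b] [a' b']; rewrite /shift_twist /= => -[ea /addIr eb].
by move: ea; rewrite eb => /addIr ->.
Qed.

(* The elements of the wreath product of A by B, acting on A * B. *)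
Definition wreath f k : {perm A * B} := perm (@shift_twist_inj f k).

Lemma wreathE f k t : wreath f k t = (t.1 + f t.2, t.2 + k).
Proof. by rewrite permE. Qed.

Lemma eq_wreath f g k : f =1 g -> wreath f k = wreath g k.
Proof. by move=> fg; apply/permP => t; rewrite !wreathE fg. Qed.

Lemma wreathM f g k l :
  (wreath f k * wreath g l)%g = wreath (fun b => f b + g (b + k)) (k + l).
Proof. by apply/permP => t; rewrite permM !wreathE /= !addrA. Qed.

Lemma wreath1 : wreath (fun=> 0) 0 = 1%g.
Proof. by apply/permP => -[a b]; rewrite wreathE perm1 /= !addr0. Qed.

Lemma wreathV f k : ((wreath f k)^-1)%g = wreath (fun b => - f (b - k)) (- k).
Proof.
apply: (mulgI (wreath f k)); rewrite mulgV wreathM subrr -wreath1.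
by apply: eq_wreath => b; rewrite addrK subrr.
Qed.

Lemma wreath_inj f g k l : wreath f k = wreath g l -> f =1 g /\ k = l.
Proof.
move=> eq_w; split=> [b|].
  have := congr1 (fun s : {perm A * B} => (s (0, b)).1) eq_w.
  by rewrite !wreathE /= !add0r.
have := congr1 (fun s : {perm A * B} => (s (0, 0)).2) eq_w.
by rewrite !wreathE /= !add0r.
Qed.

Lemma wreathX f k n :
  (wreath f k ^+ n)%g = wreath (fun b => \sum_(i < n) f (b + k *+ i)) (k *+ n).
Proof.
elim: n => [|n IHn].
  by rewrite expg0 mulr0n -wreath1; apply: eq_wreath => b; rewrite big_ord0.
rewrite expgSr IHn wreathM mulrSr; apply: eq_wreath => b.
by rewrite big_ord_recr.
Qed.

Lemma wreath_base_expg f n b : (wreath f 0 ^+ n = 1)%g -> f b *+ n = 0.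
Proof.
rewrite wreathX -wreath1 => /wreath_inj[/(_ b) + _] => <-.
rewrite (eq_bigr (fun=> f b)) => [|i _]; last by rewrite mul0rn addr0.
by rewrite sumr_const card_ord.
Qed.

End WreathPermutations.

Section PrimeWreath.
Variables (p n : nat).
Hypotheses (p_prime : prime p) (n_gt1 : (1 < n)%N).

(** Its sum over F_p vanishes, so together with a nonzero shift it gives an element of order p,
    while as a base element it has order n; it is also the base of a commutator. *)
Definition delta01 (b : 'F_p) : 'Z_n := (b == 0)%:R - (b == 1)%:R.

Lemma delta01_0 : delta01 0 = 1.
Proof. by rewrite /delta01 eqxx eq_sym oner_eq0 subr0. Qed.

Lemma sum_delta01 : \sum_b delta01 b = 0.
Proof.
have one_term (c : 'F_p) : \sum_(b : 'F_p) ((b == c)%:R : 'Z_n) = 1.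
  rewrite (bigD1 c) //= eqxx big1 ?addr0 // => b nbc.
  by rewrite (negPf nbc).
by rewrite sumrB !one_term subrr.
Qed.

(** A nonzero k generates F_p, so its orbit runs through every point once. *)
Lemma sum_orbit_prime (f : 'F_p -> 'Z_n) k b : k != 0 ->
  \sum_(i < p) f (b + k *+ i) = \sum_c f c.
Proof.
move=> k0; have inj : injective (fun i : 'I_p => b + k *+ i).
  move=> i j /addrI; rewrite -(mulr_natr k i) -(mulr_natr k j) => /(mulfI k0).
  move/(congr1 (@nat_of_ord _)); rewrite !val_Fp_nat // !modn_small // => eqij.
  exact: val_inj.
have bij : bijective (fun i : 'I_p => b + k *+ i).
  by apply: inj_card_bij => //; rewrite card_Fp // card_ord.
by rewrite [RHS](reindex _ (onW_bij _ bij)).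
Qed.

Lemma wreath_expg_prime (f : 'F_p -> 'Z_n) k : k != 0 ->
  \sum_b f b = 0 -> (wreath f k ^+ p = 1)%g.
Proof.
move=> k0 f0; rewrite wreathX -wreath1.
have -> : k *+ p = 0.
  by rewrite -mulr_natr (pcharf0 (pchar_Fp p_prime)) mulr0.
by apply: eq_wreath => b; rewrite sum_orbit_prime.
Qed.

Lemma wreath_commg_delta :
  ([~ wreath (fun=> 0) 1%R, wreath (fun b : 'F_p => (b == 0)%:R : 'Z_n) 0] =
   wreath delta01 0)%g.
Proof.
set t := wreath _ 1; set v := wreath _ 0.
apply: (mulgI (v * t)%g); rewrite -commgC !wreathM !add0r !addr0.
apply: eq_wreath => b; rewrite add0r addr0 /delta01.
have -> : (b + 1 == 1) = (b == 0) by rewrite -subr_eq0 addrK.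
by rewrite [RHS]addrC subrK.
Qed.

Lemma wreath_delta_order N : (wreath delta01 0 ^+ N = 1)%g -> (n %| N)%N.
Proof.
move=> /(wreath_base_expg 0); rewrite delta01_0 => /(congr1 val) /=.
by rewrite val_Zp_nat // => /eqP.
Qed.

End PrimeWreath.

(** * Separating words by finite quotients *)

Section Separation.
Variables (p r s : nat) (e : 'I_r -> nat).
Hypotheses (p_prime : prime p) (e_gt0 : forall i, (0 < e i)%N).

Let F := free_group (std_gen r s).
Local Notation q i := (p ^ logn p (e i))%N.

(** The second clause kills the prime-to-p part of the torsion, so that the order of x_i divides
    q_i. Both clauses survive direct products, which lets separating quotients be combined. *)
Definition admissible (G : groupType) (h : F -> G) :=
  (forall w, std_rel s e w -> h w = 1%g) /\
  (forall i, (h (gen_x s i) ^+ q i)%g = 1%g).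

Definition separated (w : F) := exists (G : finGroupType)
  (h : {multiplicative F -> G}), admissible h /\ h w <> 1%g.

Lemma separated_seq (t : seq F) : (forall w, w \in t -> separated w) ->
  exists (G : finGroupType) (h : {multiplicative F -> G}),
    admissible h /\ forall w, w \in t -> h w <> 1%g.
Proof.
elim: t => [|w t IHt] sep_t.
  pose h : F -> {perm 'I_0} := fun=> 1%g.
  have hM : {morph h : u v / u * v >-> u * v}%g by move=> u v; rewrite mulg1.
  pose hh : {multiplicative F -> {perm 'I_0}} :=
    HB.pack h (isMultiplicative.Build _ _ h hM).
  exists {perm 'I_0}, hh.
  by do !split=> //= *; rewrite ?expg1n.
have [|G [h [[h1 hx] ht]]] := IHt.
  by move=> u tu; apply: sep_t; rewrite inE tu orbT.
have [G' [h' [[h1' hx'] hw]]] := sep_t w (mem_head _ _).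
pose k (u : F) : (G * G')%type := (h u, h' u).
have kM : {morph k : u v / u * v >-> u * v}%g.
  by move=> u v; rewrite /k !gmulfM.
pose kk : {multiplicative F -> (G * G')%type} :=
  HB.pack k (isMultiplicative.Build _ _ k kM).
exists (G * G')%type, kk; split; last first.
  move=> u; rewrite inE => /orP[/eqP->|/ht tu] [].
    by move=> _ /hw.
  by move=> /tu.
split=> [u Ru|i]; first by rewrite /= /k h1 ?h1'.
by rewrite -homgX /= /k !homgX hx hx'.
Qed.

Lemma admissible_lift (G : groupType) (x : 'I_r -> G) (u v : 'I_s -> G) :
  (forall i, (x i ^+ q i)%g = 1%g) ->
  ((\prod_(i < r) x i) * \prod_(j < s) [~ u j, v j])%g = 1%g ->
  exists h : {multiplicative F -> G}, [/\ admissible h,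
    forall i, h (gen_x s i) = x i, forall j, h (gen_u r j) = u j &
    forall j, h (gen_v r j) = v j].
Proof.
move=> xq long1; pose gen (y : std_gen r s) : G :=
  match y with inl i => x i | inr (inl j) => u j | inr (inr j) => v j end.
pose h : {multiplicative F -> G} := fg_lift gen.
have hx i : h (gen_x s i) = x i by exact: fg_lift_var.
have hu j : h (gen_u r j) = u j by exact: fg_lift_var.
have hv j : h (gen_v r j) = v j by exact: fg_lift_var.
exists h; split=> //; split=> [w|i]; last by rewrite hx.
case=> [[i ->]|->].
  rewrite homgX hx; have /dvdnP[m ->] : (q i %| e i)%N by exact: pfactor_dvdnn.
  by rewrite mulnC expgM xq expg1n.
rewrite gmulfM !homg_prod -[RHS]long1; congr (_ * _)%g;
  apply: eq_bigr => i _ //.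
by rewrite homgR hu hv.
Qed.

Lemma prod_nth (G : groupType) (l : seq G) n : (size l <= n)%N ->
  (\prod_(i < n) nth 1 l i = \prod_(x <- l) x)%g.
Proof.
move=> ltn; rewrite [RHS](big_nth 1%g) big_mkord.
rewrite (big_ord_widen n (nth 1%g l)) //.
rewrite [RHS]big_mkcond; apply: eq_bigr => i _.
by case: ltnP => // ?; rewrite nth_default.
Qed.

(** Generators beyond the ends of the lists go to 1, so only the few nontrivial images have to be
    given. *)
Lemma admissible_seq (G : groupType) (l lu lv : seq G) : (size l <= r)%N ->
  (size lu <= s)%N -> (size lv <= s)%N ->
  (forall i : 'I_r, (i < size l)%N -> (nth 1 l i ^+ q i = 1)%g) ->
  ((\prod_(x <- l) x) * \prod_(j < s) [~ nth 1 lu j, nth 1 lv j])%g = 1%g ->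
  exists h : {multiplicative F -> G}, [/\ admissible h,
    forall i, h (gen_x s i) = nth 1%g l i,
    forall j, h (gen_u r j) = nth 1%g lu j &
    forall j, h (gen_v r j) = nth 1%g lv j].
Proof.
move=> lr lus lvs lq long1; apply: admissible_lift => [i|].
  case: (ltnP i (size l)) => [/lq //|?]; by rewrite nth_default // expg1n.
by rewrite (prod_nth lr).
Qed.

Lemma admissible_seq0 (G : groupType) (l : seq G) : (size l <= r)%N ->
  (forall i : 'I_r, (i < size l)%N -> (nth 1 l i ^+ q i = 1)%g) ->
  (\prod_(x <- l) x)%g = 1%g ->
  exists2 h : {multiplicative F -> G}, admissible h &
    forall i, h (gen_x s i) = nth 1%g l i.
Proof.
move=> lr lq l1.
have [||||h [hA hx _ _]] := @admissible_seq G l [::] [::] lr => //.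
  by rewrite l1 mul1g big1 // => j _; rewrite nth_default // commg1.
by exists h.
Qed.

Lemma prod_comm1 (G : groupType) (a b : G) : (0 < s)%N ->
  (\prod_(j < s) [~ nth 1 [:: a] j, nth 1 [:: b] j])%g = [~ a, b]%g.
Proof.
move=> s0; transitivity (\prod_(j < s) nth 1 [:: [~ a, b]] j)%g.
  by apply: eq_bigr => -[[|[|j]] ltj] _ //=; rewrite commg1.
by rewrite prod_nth // big_seq1.
Qed.

(** In Z/q_i, send x_i to a generator and x_0 to its inverse; divisibility of q_0 by q_i makes the
    latter legitimate. *)
Lemma cyclic_quotient (i : 'I_r) : (0 < i)%N ->
  (forall k : 'I_r, k = 0%N :> nat -> (q i %| q k)%N) ->
  exists (G : finGroupType) (h : {multiplicative F -> G}),
    [/\ admissible h, #[h (gen_x s i)]%g = q i &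
      forall k : 'I_r, k != i -> (0 < k)%N -> h (gen_x s k) = 1%g].
Proof.
move=> i0 qk; have q0 : (0 < q i)%N by rewrite expn_gt0 prime_gt0.
pose G : finGroupType := 'I_(q i).-1.+1; pose g : G := Zp1.
have og : #[g]%g = q i by rewrite order_Zp1 prednK.
pose l := g^-1%g :: rcons (nseq i.-1 1%g) g.
have sl : size l = i.+1 by rewrite /= size_rcons size_nseq prednK.
have nthl (k : nat) : nth 1%g l k =
    if k == 0%N then g^-1%g else if k == i :> nat then g else 1%g.
  rewrite /l; case: k => //= k; rewrite nth_rcons size_nseq nth_nseq if_same.
  by rewrite -(prednK i0) /= eqSS; case: ltngtP.
have [|k _||h hA hx] := @admissible_seq0 G l; first by rewrite sl.
- rewrite nthl; case: eqP => [k0|_]; last first.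
    case: eqP => [/val_inj->|_]; last by rewrite expg1n.
    by rewrite -og expg_order.
  have /dvdnP[m ->] := qk k k0.
  by rewrite mulnC expgM -{1}og -orderV expg_order expg1n.
- rewrite /l big_cons -cats1 big_cat big_seq1 /= big_nseq.
  suff -> : iter i.-1 (mulg 1) 1%g = 1%g :> G by rewrite mul1g mulVg.
  by elim: i.-1 => //= m ->; rewrite mulg1.
exists G, h; split=> // [|k nki k0]; rewrite hx nthl.
  by rewrite eqxx gtn_eqF.
by rewrite gtn_eqF // (inj_eq val_inj) (negPf nki).
Qed.

End Separation.

(** * Quotients available under the four conditions *)

Section ConditionQuotients.
Variables (p r s : nat) (e : 'I_r -> nat).
Hypotheses (p_prime : prime p) (e_gt0 : forall i, (0 < e i)%N).

Local Notation q i := (p ^ logn p (e i))%N.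

Lemma expg_pfactor (G : groupType) (g : G) (k : nat) i :
  (p ^ k %| e i)%N -> (g ^+ (p ^ k) = 1)%g -> (g ^+ q i = 1)%g.
Proof.
rewrite pfactor_dvdn // => lek gk.
by rewrite -(subnKC lek) expnD expgM gk expg1n.
Qed.

Lemma wreath_base_expgn (B : finZmodType) n (f : B -> 'Z_n) : (1 < n)%N ->
  (wreath f 0 ^+ n = 1)%g.
Proof.
move=> n1; rewrite wreathX mul0rn -wreath1; apply: eq_wreath => b.
rewrite (eq_bigr (fun=> f b)) => [|i _]; last by rewrite mul0rn addr0.
by rewrite sumr_const card_ord -mulr_natr pchar_Zp // mulr0.
Qed.

Lemma expgV1 (G : groupType) (g : G) n : (g ^+ n = 1 -> g^-1 ^+ n = 1)%g.
Proof. by move=> gn; rewrite expVgn gn invg1. Qed.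

(* For s > 0, the image of x_0 is the inverse of the commutator of the shift and
   a base element; otherwise it is that commutator, x_1 maps to the shift, and
   the image of x_2 that kills the long relator also has order p. *)
Lemma separated_x0 (i : 'I_r) : i = 0%N :> nat -> (0 < logn p (e i))%N ->
  (0 < s)%N \/ (3 <= r)%N /\ (forall k : 'I_r, (k < 3)%N -> (p %| e k)%N) ->
  separated p e (gen_x s i ^+ (p ^ (logn p (e i)).-1))%g.
Proof.
move=> i0 a0 cond; set n := q i; set m := (p ^ _)%N.
have m_n : (m < n)%N by rewrite ltn_exp2l ?prime_gt1 // prednK.
have m0 : (0 < m)%N by rewrite expn_gt0 prime_gt0.
have n1 : (1 < n)%N := leq_ltn_trans m0 m_n.
pose d := @delta01 p n; pose w := wreath d 0.
have wn : (w ^+ n = 1)%g by exact: wreath_base_expgn.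
have wm : (w ^+ m)%g <> 1%g.
  move=> /(wreath_delta_order n1) /(dvdn_leq m0).
  by rewrite leqNgt m_n.
pose t := @wreath 'Z_n 'F_p (fun=> 0) 1.
case: cond => [s0|[r3 p_e]].
  pose v := wreath (fun b : 'F_p => (b == 0)%:R : 'Z_n) 0.
  have tv : [~ t, v]%g = w by exact: wreath_commg_delta.
  have [|||k||h [hA hx _ _]] :=
    @admissible_seq p r s e _ [:: w^-1%g] [:: t] [:: v] => //.
  - exact: leq_ltn_trans (leq0n i) (ltn_ord i).
  - rewrite ltnS leqn0 => /eqP k0.
    have -> : k = i by apply: val_inj; rewrite /= i0.
    by rewrite i0 /=; exact: expgV1.
  - by rewrite big_seq1 prod_comm1 // tv mulVg.
  exists _, h; split=> //; rewrite homgX hx i0 /= expVgn => /eqP.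
  by rewrite invg_eq1 => /eqP.
have t1 : (t ^+ (p ^ 1)%N)%g = 1%g.
  by rewrite expn1; apply: wreath_expg_prime; rewrite ?oner_eq0 ?big1.
pose u := wreath d 1.
have d1 : (u ^+ (p ^ 1)%N)%g = 1%g.
  rewrite expn1; apply: wreath_expg_prime; rewrite ?oner_eq0 //.
  exact: sum_delta01.
have [||h hA hx] := @admissible_seq0 p r s e _
  [:: w; t; u^-1%g] r3.
- case=> [[|[|[|k]]] ltk] // _ /=.
  + by rewrite (_ : Ordinal ltk = i) //; apply: val_inj.
  + by apply: (expg_pfactor (k := 1)) => //; rewrite expn1 p_e.
  + apply: (expg_pfactor (k := 1)); first by rewrite expn1 p_e.
    exact: expgV1.
- rewrite !big_cons big_nil mulg1 mulgA wreathM add0r.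
  by rewrite (eq_wreath (g := d)) ?mulgV // => b; rewrite addr0.
by exists _, h; split=> //; rewrite homgX hx i0.
Qed.

Lemma wreath_commV n (B : finZmodType) (f : B -> 'Z_n) (k : B) :
  ((wreath (fun=> 0) k)^-1 * wreath f k)%g = wreath (fun b => f (b - k)) 0.
Proof.
apply: (mulgI (wreath (fun=> 0) k)); rewrite mulVKg wreathM addr0.
by apply: eq_wreath => b; rewrite add0r addrK.
Qed.


(** Equal shifts cancel in x_i^-1 x_j, leaving a base element with value f 0 = 1 at k. Its (n+1)-st
    power has value n + 1 there, nonzero in Z/(n+2). *)
Lemma separated_shift_quotient (B : finZmodType) n (f : B -> 'Z_n.+2) (k : B)
    (l : seq {perm 'Z_n.+2 * B}) (i j : 'I_r) :
  f 0 = 1 -> (size l <= r)%N ->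
  (forall i : 'I_r, (i < size l)%N -> (nth 1 l i ^+ q i = 1)%g) ->
  (\prod_(x <- l) x = 1)%g ->
  nth 1%g l i = wreath (fun=> 0) k -> nth 1%g l j = wreath f k ->
  separated p e (((gen_x s i)^-1 * gen_x s j) ^+ n.+1)%g.
Proof.
move=> f0 lr lq l1 li lj; have [h hA hx] := admissible_seq0 s lr lq l1.
exists _, h; split=> //; rewrite homgX gmulfM homgV !hx li lj wreath_commV.
move/(wreath_base_expg k); rewrite subrr f0 => /(congr1 (@nat_of_ord _)).
by rewrite val_Zp_nat // modn_small.
Qed.

(* The element w has infinite order in the quotient Z of Gamma in the first
   case, in a quotient inside the wreath product of Z by Z/m, for m = p, 2, 4,
   in the others. *)
Lemma separated_large : std_condition p s e ->
  exists w : free_group (std_gen r s), forall n, separated p e (w ^+ n.+1)%g.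
Proof.
have p_gt1 := prime_gt1 p_prime.
case=> [s0|[p3 r3 p_e]|[p2 r4 p_e]|[p2 r3 p_e p_e2]].
- exists (gen_u r (Ordinal s0)) => n; pose g : 'Z_n.+2 := Zp1.
  have [|||||h [hA _ hu _]] := @admissible_seq p r s e _ [::] [:: g] [::] => //.
    by rewrite big_nil mul1g big1 // => j _; rewrite nth_nil commg1.
  exists _, h; split=> //; rewrite homgX hu /= => /eqP.
  by rewrite -order_dvdn order_Zp1 gtnNdvd.
- exists ((gen_x s (Ordinal (leq_trans (isT : 0 < 3)%N r3)))^-1 *
    gen_x s (Ordinal (leq_trans (isT : 1 < 3)%N r3)))%g => n.
  pose d := @delta01 p n.+2; pose t := @wreath 'Z_n.+2 'F_p (fun=> 0) 1.
  pose u := wreath d 1.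
  have tu : (t * u)%g = wreath (fun b => d (b + 1)) (1 + 1).
    by rewrite wreathM; apply: eq_wreath => b; rewrite add0r.
  have one0 : (1 : 'F_p) != 0 by exact: oner_neq0.
  (* Here p >= 3 enters: the shift of tu is 2, and it must be nonzero for tu to have order p as
     well. *)
  have two0 : (1 + 1 : 'F_p) != 0.
    by rewrite -mulr2n -(dvdn_pcharf (pchar_Fp p_prime)) gtnNdvd.
  have sum_d1 : \sum_b d (b + 1) = 0.
    by rewrite -[RHS](sum_delta01 p n.+2) [RHS](reindex_inj (addIr 1)).
  have tp : (t ^+ (p ^ 1)%N)%g = 1%g.
    by rewrite expn1; apply: wreath_expg_prime; rewrite ?big1.
  have up : (u ^+ (p ^ 1)%N)%g = 1%g.
    by rewrite expn1; apply: wreath_expg_prime => //; exact: sum_delta01.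
  have tup : ((t * u) ^+ (p ^ 1)%N)%g = 1%g.
    by rewrite expn1 tu; exact: wreath_expg_prime.
  apply: (@separated_shift_quotient 'F_p n d 1 [:: t; u; (t * u)^-1%g]) => //.
  + exact: delta01_0.
  + case=> [[|[|[|k]]] ltk] // _ /=; apply: (expg_pfactor (k := 1)) => //.
    * by rewrite expn1 p_e.
    * by rewrite expn1 p_e.
    * by rewrite expn1 p_e.
    * exact: expgV1.
  + by rewrite !big_cons big_nil mulg1 mulgA mulgV.
- exists ((gen_x s (Ordinal (leq_trans (isT : 0 < 4)%N r4)))^-1 *
    gen_x s (Ordinal (leq_trans (isT : 1 < 4)%N r4)))%g => n.
  pose d := @delta01 p n.+2; pose t := @wreath 'Z_n.+2 'F_p (fun=> 0) 1.
  pose u := wreath d 1.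
  have one0 : (1 : 'F_p) != 0 by exact: oner_neq0.
  have tp : (t ^+ (p ^ 1)%N)%g = 1%g.
    by rewrite expn1; apply: wreath_expg_prime; rewrite ?big1.
  have up : (u ^+ (p ^ 1)%N)%g = 1%g.
    by rewrite expn1; apply: wreath_expg_prime => //; exact: sum_delta01.
  apply: (@separated_shift_quotient 'F_p n d 1 [:: t; u; u^-1%g; t^-1%g]) => //.
  + exact: delta01_0.
  + case=> [[|[|[|[|k]]]] ltk] // _ /=; apply: (expg_pfactor (k := 1)) => //.
    * by rewrite expn1 p2 p_e.
    * by rewrite expn1 p2 p_e.
    * by rewrite expn1 p2 p_e.
    * exact: expgV1.
    * by rewrite expn1 p2 p_e.
    * exact: expgV1.
  + by rewrite !big_cons big_nil mulg1 mulKVg mulgV.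
- exists ((gen_x s (Ordinal (leq_trans (isT : 0 < 3)%N r3)))^-1 *
    gen_x s (Ordinal (leq_trans (isT : 1 < 3)%N r3)))%g => n.
  (* d sums to 0 over each coset of {0, 2}: hence u^4 = 1, and (tu)^2 = 1 because tu has shift 2.
     Neither identity depends on n. *)
  pose d (b : 'Z_4) : 'Z_n.+2 := (b == 0)%:R - (b == 2)%:R.
  pose t := @wreath 'Z_n.+2 'Z_4 (fun=> 0) 1; pose u := wreath d 1.
  have tu : (t * u)%g = wreath (fun b => d (b + 1)) (1 + 1).
    by rewrite wreathM; apply: eq_wreath => b; rewrite add0r.
  have tp : (t ^+ (2 ^ 2)%N)%g = 1%g.
    rewrite wreathX -wreath1 (_ : 1 *+ (2 ^ 2) = 0 :> 'Z_4); last exact/val_inj.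
    by apply: eq_wreath => b; rewrite big1.
  have up : (u ^+ (2 ^ 2)%N)%g = 1%g.
    rewrite wreathX -wreath1 (_ : 1 *+ (2 ^ 2) = 0 :> 'Z_4); last exact/val_inj.
    apply: eq_wreath => b; rewrite !big_ord_recr big_ord0 /= /d.
    by case: b => [[|[|[|[|b]]]] ltb] //=;
      rewrite /= ?(subr0, sub0r, add0r, addr0, subrr, addNr).
  have tup : ((t * u) ^+ (2 ^ 1)%N)%g = 1%g.
    rewrite tu wreathX -wreath1 (_ : (1 + 1) *+ (2 ^ 1) = 0 :> 'Z_4);
      last exact/val_inj.
    apply: eq_wreath => b; rewrite !big_ord_recr big_ord0 /= /d.
    by case: b => [[|[|[|[|b]]]] ltb] //=;
      rewrite /= ?(subr0, sub0r, add0r, addr0, subrr, addNr).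
  apply: (@separated_shift_quotient 'Z_4 n d 1 [:: t; u; (t * u)^-1%g]) => //.
  + by rewrite /d eqxx subr0.
  + case=> [[|[|[|k]]] ltk] // _ /=.
    * by apply: (expg_pfactor (k := 2)); rewrite p2 ?p_e.
    * by apply: (expg_pfactor (k := 2)); rewrite p2 ?p_e.
    * by apply: (expg_pfactor (k := 1)); rewrite p2 ?p_e2 //; exact: expgV1.
  + by rewrite !big_cons big_nil mulg1 mulgA mulgV.
Qed.

End ConditionQuotients.

Section FullQuotient.
Variables (p r s : nat) (e : 'I_r -> nat).
Hypotheses (p_prime : prime p) (e_gt0 : forall i, (0 < e i)%N).
Hypothesis e_sorted : forall i j : 'I_r,
  (i <= j)%N -> (logn p (e j) <= logn p (e i))%N.

Local Notation q i := (p ^ logn p (e i))%N.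

Lemma order_admissible (G : finGroupType)
    (h : {multiplicative free_group (std_gen r s) -> G}) i :
  admissible p e h ->
  ((0 < logn p (e i))%N -> h (gen_x s i ^+ (p ^ (logn p (e i)).-1))%g <> 1%g) ->
  #[h (gen_x s i)]%g = q i.
Proof.
case=> _ /(_ i) hq; rewrite homgX; set g := h _ in hq *; move=> hn.
have /(dvdn_pfactor _ _ p_prime)[m lem og] : (#[g]%g %| q i)%N.
  by rewrite order_dvdn hq.
rewrite og; congr (p ^ _)%N; apply/eqP; rewrite eqn_leq lem /= leqNgt.
apply/negP => ltm; apply: hn; first exact: leq_ltn_trans ltm.
by apply/eqP; rewrite -order_dvdn og dvdn_exp2l // -ltnS (ltn_predK ltm).
Qed.

(** Only x_0 needs the conditions. For i > 0 the ordering of the valuations makes q_i divide q_0, so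
    a cyclic quotient suffices. *)
Lemma separated_gen_x i : std_condition p s e -> (0 < logn p (e i))%N ->
  separated p e (gen_x s i ^+ (p ^ (logn p (e i)).-1))%g.
Proof.
move=> cond a0; have [i0|i0] := posnP i.
  apply: separated_x0 => //.
  case: cond => [s0|[_ r3 p_e]|[p2 r4 p_e]|[p2 r3 p_e p_e2]]; [by left|right..].
  - by split.
  - by split=> [|k ltk]; [exact: ltnW | rewrite p2 p_e // ltnS ltnW].
  - split=> // k ltk; rewrite p2; have [lt2|ge2] := ltnP k 2.
      by apply: dvdn_trans (p_e k lt2).
    by apply: p_e2; apply/eqP; rewrite eqn_leq ge2 andbT -ltnS.
have [|G [h [hA og _]]] := cyclic_quotient s (e := e) p_prime i0.
  by move=> k k0; rewrite dvdn_exp2l // e_sorted // k0.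
exists G, h; split=> //; rewrite homgX => /eqP; rewrite -order_dvdn og.
by rewrite dvdn_Pexp2l ?prime_gt1 // leqNgt prednK // leqnn.
Qed.

(** Finitely many words are separated at once: a power of each x_i just below q_i, which forces its
    exact order, and w^(n!), which forces the image of w to have order above n. *)
Lemma full_quotient n : std_condition p s e ->
  exists (G : finGroupType)
    (h : {multiplicative free_group (std_gen r s) -> G}),
  [/\ forall w, std_rel s e w -> h w = 1%g,
      forall i, #[h (gen_x s i)]%g = q i & (n < #|range_set h|)%N].
Proof.
move=> cond; have [w sep_w] := separated_large p_prime e_gt0 cond.
pose xq i := (gen_x s i ^+ (p ^ (logn p (e i)).-1))%g.
pose t := (w ^+ n`!)%g :: [seq xq i | i <- enum 'I_r & (0 < logn p (e i))%N].
have [|G [h [hA ht]]] := @separated_seq p r s e t.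
  move=> u; rewrite inE => /orP[/eqP->|/mapP[i + ->]].
    by rewrite -(prednK (fact_gt0 n)).
  by rewrite mem_filter => /andP[a0 _]; exact: separated_gen_x.
exists G, h; split=> [|i|]; first by case: hA.
  apply: order_admissible => // a0; apply: ht; rewrite inE; apply/orP; right.
  by apply: map_f; rewrite mem_filter a0 mem_enum.
have le_order : (#[h w]%g <= #|range_set h|)%N.
  apply/subset_leq_card.
  by rewrite (cycle_subG _ (range_group h)) mem_range_set.
apply: leq_trans le_order; rewrite ltnNge; apply/negP => le_n.
apply: (ht _ (mem_head _ _)); rewrite homgX; apply/eqP.
by rewrite -order_dvdn dvdn_fact // order_gt0.
Qed.

End FullQuotient.

(** * Dihedral groups of order 2n as permutation groups *)

Section DihedralQuotient.
Variable n : nat.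
Hypothesis n_gt1 : (1 < n)%N.

(** The second coordinate keeps the flip of order 2 and outside the rotations even for n = 2, where
    negation on Z/n is the identity. *)
Let T := ('Z_n * 'Z_2)%type.

Fact dihedral_rot_inj : injective (fun t : T => (t.1 + 1, t.2)).
Proof.
move=> [a b] [a' b'] eq_t.
by have /= -> := addIr 1 (congr1 fst eq_t); have /= -> := congr1 snd eq_t.
Qed.

Fact dihedral_flip_inj : injective (fun t : T => (- t.1, t.2 + 1)).
Proof.
move=> [a b] [a' b'] eq_t.
have /= -> := oppr_inj (congr1 fst eq_t).
by have /= -> := addIr 1 (congr1 snd eq_t).
Qed.

Definition dihedral_rot : {perm T} := perm dihedral_rot_inj.
Definition dihedral_flip : {perm T} := perm dihedral_flip_inj.

Lemma dihedral_rotX k t : (dihedral_rot ^+ k)%g t = (t.1 + k%:R, t.2).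
Proof.
elim: k => [|k IHk]; first by rewrite expg0 perm1 addr0; case: t.
by rewrite expgSr permM IHk permE /= -addrA natr1.
Qed.

Lemma order_dihedral_rot : #[dihedral_rot]%g = n.
Proof.
apply/eqP; rewrite eqn_dvd order_dvdn; apply/andP; split.
  apply/eqP/permP => t.
  by rewrite dihedral_rotX pchar_Zp // addr0 perm1; case: t.
have := congr1 fst (dihedral_rotX #[dihedral_rot]%g (0, 0)).
rewrite expg_order perm1 add0r => /esym/(congr1 (@nat_of_ord _)).
by rewrite val_Zp_nat // => /eqP.
Qed.

Lemma order_dihedral_flip : #[dihedral_flip]%g = 2.
Proof.
apply: nt_prime_order => //.
  apply/permP => -[a b]; rewrite expgS expg1 permM !permE /= opprK -addrA.
  by rewrite (_ : 1 + 1 = 0 :> 'Z_2) ?addr0 //; exact: val_inj.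
by apply/eqP => /permP /(_ (0, 0)) /(congr1 snd); rewrite permE perm1.
Qed.

Lemma order_dihedral_mul : #[dihedral_rot * dihedral_flip]%g = 2.
Proof.
apply: nt_prime_order => //.
  apply/permP => -[a b]; rewrite expgS expg1 !permM !permE /= -addrA.
  rewrite (_ : 1 + 1 = 0 :> 'Z_2) ?addr0; last exact: val_inj.
  by rewrite opprD opprK addrK.
by apply/eqP => /permP /(_ (0, 0)) /(congr1 snd); rewrite permM !permE.
Qed.

Lemma dihedral_flip_notin : dihedral_flip \notin <[dihedral_rot]>%g.
Proof.
apply/negP => /cycleP[k] /permP /(_ (0, 0)) /(congr1 snd).
by rewrite dihedral_rotX permE.
Qed.

End DihedralQuotient.

(** * The deficiency of the standard presentation *)

Section StandardDeficiency.
Variables (R : realType) (p r s : nat) (e : 'I_r -> nat).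
Hypotheses (p_prime : prime p) (e_ge2 : forall i, (2 <= e i)%N).

Let F := free_group (std_gen r s).

Lemma pval_unique (X : choiceType) (w : free_group X) k :
  is_pval p w k -> Defs.pval p w = k.
Proof.
move=> [wk maxk]; apply: xget_unique; first by split.
by move=> l [wl maxl]; apply/eqP; rewrite eqn_leq maxk ?maxl.
Qed.

Lemma Zp_expgn n (y : 'I_n.+1) : (y ^+ n.+1 = 1)%g.
Proof. by rewrite Zp_expg; apply: val_inj; rewrite /= modnMl. Qed.

(** The exponent sum of x_i modulo n + 1, an invariant that tells the relators apart and obstructs
    roots. *)
Lemma hom_gen_x n (i : 'I_r) : exists h : {multiplicative F -> 'I_n.+1},
  [/\ h (gen_x s i) = Zp1, forall j, j != i -> h (gen_x s j) = 1%g &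
      h (long_rel r s) = Zp1].
Proof.
pose gen (y : std_gen r s) : 'I_n.+1 := if y == inl i then Zp1 else 1%g.
pose h : {multiplicative F -> 'I_n.+1} := fg_lift gen.
have hE y : h (fg_var y) = gen y by exact: fg_lift_var.
have hx j : h (gen_x s j) = if j == i then Zp1 else 1%g.
  by rewrite hE /gen (inj_eq (@inl_inj _ _)).
exists h; split=> [|j /negPf nj|]; rewrite ?hx ?eqxx ?nj //.
rewrite gmulfM !homg_prod [X in (_ * X)%g]big1 => [|j _]; last first.
  by rewrite homgR !hE /gen /= comm1g.
rewrite mulg1 (eq_bigr (fun j => if j == i then Zp1 else 1%g)) => [|j _ //].
by rewrite -big_mkcond big_pred1_eq.
Qed.

Lemma Zp1_expg_eq1 n k : (Zp1 ^+ k == 1 :> 'I_n.+1)%g = (n.+1 %| k)%N.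
Proof. by rewrite -order_dvdn order_Zp1. Qed.

(** A root of order p^(a+1), with a the valuation of e_i, would make the exponent sum e_i divisible
    by p^(a+1). *)
Lemma pval_gen_x (i : 'I_r) : Defs.pval p (gen_x s i ^+ e i)%g = logn p (e i).
Proof.
have e0 : (0 < e i)%N by exact: ltnW.
apply: pval_unique; split=> [|l [v xv]].
  exists (gen_x s i ^+ (e i %/ p ^ logn p (e i)))%g.
  by rewrite -expgM divnK // pfactor_dvdnn.
rewrite leqNgt; apply/negP => lt_l; set N := (p ^ (logn p (e i)).+1)%N.
have N0 : (0 < N)%N by rewrite expn_gt0 prime_gt0.
have [h [hx _ _]] := hom_gen_x N.-1 i.
have := congr1 h xv; rewrite !homgX hx => eq_h.
have : (Zp1 ^+ e i == 1 :> 'I_N.-1.+1)%g.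
  have vN : (h v ^+ N = 1)%g by have := Zp_expgn (h v); rewrite prednK.
  by rewrite eq_h -(subnKC lt_l) expnD expgM vN expg1n.
by rewrite Zp1_expg_eq1 prednK // pfactor_dvdn // ltnn.
Qed.

Lemma gen_x_expg_neq1 (i : 'I_r) : (gen_x s i ^+ e i)%g != 1%g.
Proof.
apply/eqP => x1; have [h [hx _ _]] := hom_gen_x (e i) i.
have /eqP := congr1 h x1; rewrite homgX hx homg1 Zp1_expg_eq1.
by rewrite gtnNdvd // ltnW.
Qed.

(** Relators form a set, where coinciding words would be counted once; their distinctness therefore
    enters the value of the deficiency. *)
Lemma gen_x_expg_inj : injective (fun i : 'I_r => gen_x s i ^+ e i)%g.
Proof.
move=> i j eq_x; apply/eqP/negPn/negP => nij.
have [h [hx hy _]] := hom_gen_x (e i) i.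
have /eqP := congr1 h eq_x; rewrite !homgX hx hy 1?eq_sym // expg1n eq_sym.
by rewrite Zp1_expg_eq1 gtnNdvd // ltnW.
Qed.

Lemma long_rel_neq_gen_x (i : 'I_r) : long_rel r s <> (gen_x s i ^+ e i)%g.
Proof.
move=> eq_x; have [h [hx _ hl]] := hom_gen_x (e i).-1 i.
have := congr1 h eq_x; rewrite homgX hx hl => /esym/eqP.
rewrite -(prednK (ltnW (e_ge2 i))) expgSr -[X in _ == X]mul1g.
rewrite (inj_eq (mulIg _)) Zp1_expg_eq1 prednK ?(ltnW (e_ge2 i)) //.
by case: (e i) (e_ge2 i) => [|[|m]] // _; rewrite gtnNdvd /=.
Qed.

(* For s > 0, in the wreath product of Z/p^2 by Z/p the p-th power of an element
   with base f and shift k has base p f if k = 0, and a constant base otherwise;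
   delta01 is neither. *)
Lemma long_rel_not_power v :
  (0 < s)%N \/ (0 < r)%N -> long_rel r s <> (v ^+ p)%g.
Proof.
have p1 := prime_gt1 p_prime.
case=> [s0|r0] eq_l; last first.
  have [h [_ _ hl]] := hom_gen_x p.-1 (Ordinal r0).
  have /eqP := congr1 h eq_l; rewrite homgX hl.
  have -> : (h v ^+ p = 1)%g by have := Zp_expgn (h v); rewrite prednK // ltnW.
  by rewrite -[Zp1]expg1 Zp1_expg_eq1 prednK ?dvdn1 ?gtn_eqF // ltnW.
have n1 : (1 < p * p)%N by rewrite (leq_trans p1) // leq_pmulr // ltnW.
pose W : finGroupType := {perm 'Z_(p * p) * 'F_p}.
pose t : W := wreath (fun=> 0) 1.
pose u : W := wreath (fun b : 'F_p => (b == 0)%:R : 'Z_(p * p)) 0.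
pose gen (y : std_gen r s) : W := match y with
  | inl _ => 1%g
  | inr (inl j) => nth 1%g [:: t] j
  | inr (inr j) => nth 1%g [:: u] j
  end.
pose h : {multiplicative F -> W} := fg_lift gen.
have hE y : h (fg_var y) = gen y by exact: fg_lift_var.
have hl : h (long_rel r s) = wreath (@delta01 p (p * p)) 0.
  rewrite gmulfM !homg_prod [X in (X * _)%g]big1 ?mul1g; last first.
    by move=> j _; rewrite hE.
  rewrite -[RHS](wreath_commg_delta p (p * p)) -[RHS](prod_comm1 _ _ s0).
  by apply: eq_bigr => j _; rewrite homgR !hE.
move: hl; rewrite eq_l homgX.
(* W contains all permutations; h v is of wreath form because the images of the generators are and
   such elements form a subgroup. *)
have [f [k ->]] : exists f k, h v = wreath f k :> W.
  elim/free_group_gen: v {eq_l} =>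
    [|y|v1 v2 [f1 [k1 h1]] [f2 [k2 h2]]|v1 [f1 [k1 h1]]].
  - by exists (fun=> 0), 0; rewrite wreath1 homg1.
  - have wr1 : exists f k, 1%g = wreath f k :> W.
      by exists (fun=> 0), 0; rewrite wreath1.
    rewrite hE; case: y => [i|[j|j]] //=; rewrite /gen;
      case: (j : nat) => [|n] /=.
    + by exists (fun=> 0), 1.
    + by rewrite nth_nil.
    + by exists (fun b => (b == 0)%:R), 0.
    + by rewrite nth_nil.
  - by do 2!eexists; rewrite gmulfM h1 h2 wreathM.
  - by do 2!eexists; rewrite homgV h1 wreathV.
rewrite wreathX => /wreath_inj[fd _].
have [k0|k0] := eqVneq k 0.
  have := fd 0; rewrite delta01_0 => /(congr1 (fun c => c *+ p)).
  rewrite (eq_bigr (fun=> f 0)) => [|i _]; last by rewrite k0 mul0rn addr0.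
  rewrite sumr_const card_ord -mulrnA -mulr_natr pchar_Zp // mulr0.
  move/(congr1 (@nat_of_ord _)); rewrite val_Zp_nat // => /esym/eqP.
  by rewrite -/(dvdn _ _) gtnNdvd // ?ltn_Pmull // ltnW.
have := fd 1; rewrite sum_orbit_prime // -(sum_orbit_prime p_prime f 0 k0) fd.
rewrite delta01_0 /delta01 oner_eq0 eqxx sub0r => /eqP.
rewrite -subr_eq0 opprK => /eqP/(congr1 (@nat_of_ord _)).
rewrite -[1 + 1]/(2%:R) val_Zp_nat // => /eqP.
rewrite -/(dvdn _ _) gtnNdvd //.
by rewrite (leq_trans _ (leq_mul p1 p1)).
Qed.

Lemma rel_weight_gen_x (i : 'I_r) :
  rel_weight p R (gen_x s i ^+ e i)%g = p%:R ^- logn p (e i).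
Proof. by rewrite /rel_weight (negPf (gen_x_expg_neq1 i)) pval_gen_x. Qed.

(** For r = s = 0 the long relator is the empty word, of weight 0; otherwise it is not a p-th power,
    so its valuation is 0. *)
Lemma rel_weight_long : (0 < s)%N \/ (0 < r)%N ->
  rel_weight p R (long_rel r s) = 1.
Proof.
move=> rs0; rewrite /rel_weight; case: eqP => [l1|_].
  by case: (long_rel_not_power (v := 1%g) rs0); rewrite expg1n.
rewrite (_ : Defs.pval p _ = 0%N) ?expr0 ?invr1 //; apply: pval_unique.
split=> [|[|l] [v lv]] //; first by exists (long_rel r s); rewrite expn0 expg1.
case: (long_rel_not_power (v := (v ^+ (p ^ l))%g) rs0).
by rewrite -expgM -expnSr.
Qed.

Lemma def_pres_std : (0 < s)%N \/ (0 < r)%N ->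
  def_pres p R (std_rel s e) =
    (2 * s%:R - 2 + \sum_(i < r) (1 - p%:R ^- logn p (e i)))%:E.
Proof.
move=> rs0; pose t := long_rel r s :: [seq gen_x s i ^+ e i | i <- enum 'I_r]%g.
have tE : std_rel s e = [set` t]%classic.
  apply/seteqP; split=> w /=; rewrite inE.
    case=> [[i ->]|->]; rewrite ?eqxx //; apply/orP; right.
    by apply/mapP; exists i; rewrite ?mem_enum.
  by case/orP=> [/eqP->|/mapP[i _ ->]]; [right | left; exists i].
have ut : uniq t.
  rewrite /= map_inj_uniq ?enum_uniq ?andbT; last exact: gen_x_expg_inj.
  by apply/mapP => -[i _]; exact: long_rel_neq_gen_x.
have t_ge0 (w : F) : (0 <= (rel_weight p R w)%:E)%E.
  by rewrite lee_fin rel_weight_ge0.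
rewrite /def_pres tE esum_fset ?finite_seq //; last exact: finite_seq.
rewrite -fsbig_seq // sumEFin big_cons big_map big_enum /= rel_weight_long //.
rewrite (eq_bigr (fun i => p%:R ^- logn p (e i))) => [|i _]; last first.
  exact: rel_weight_gen_x.
rewrite -EFinB !card_sum !card_ord; congr EFin.
rewrite sumrB sumr_const card_ord !natrD.
by set S := \sum_(i < r) _; lra.
Qed.

End StandardDeficiency.

(** * Finite maximal p-quotient *)

Section NonPositiveCases.
Variables (R : realType) (p r : nat) (e : 'I_r -> nat).
Hypotheses (p_prime : prime p) (e_gt0 : forall i, (0 < e i)%N).
Hypothesis e_sorted : forall i j : 'I_r,
  (i <= j)%N -> (logn p (e j) <= logn p (e i))%N.
Variables (Gamma : groupType)
  (f : {multiplicative free_group (std_gen r 0) -> Gamma}).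
Hypothesis fP : presentation (std_rel 0 e) f.

(** Without generators the only derivation is 0, so the count gives deficiency at most -1. *)
Lemma def_group_no_generator : r = 0%N -> (def_group p R Gamma < 0)%E.
Proof.
move=> r0; pose rho (w : free_group (std_gen r 0)) : 'End(('F_p)^o) := \1%VF.
have rhoP : is_rep rho by split=> // u v; rewrite comp_lfun1l.
apply: (@le_lt_trans _ _ (0 - 1)%:E); last by rewrite lte_fin sub0r oppr_lt0.
apply: (def_group_le (V := ('F_p)^o) (pchar_Fp p_prime) _ fP rhoP) => // B _.
rewrite mul0r lern0 -leqn0; apply: leq_trans (dimvS (subvf B)) _.
rewrite dimvf [dim _](_ : _ = #|std_gen r 0| * 1)%N //.
by rewrite !card_sum !card_ord r0.
Qed.

(** The relation of x_0 is dropped, since the cyclic quotient only gives x_0 the order q_1. The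
    bound becomes -1 + (1 - 1/q_1) = -1/q_1, or -1 when r = 1. *)
Lemma def_group_cyclic (i0 : 'I_r) : i0 = 0%N :> nat ->
  (forall i : 'I_r, (1 < i)%N -> logn p (e i) = 0%N) ->
  (def_group p R Gamma < 0)%E.
Proof.
move=> i00 a0; have p0 : (0 : R) < p%:R by rewrite ltr0n prime_gt0.
have [G [h [[hrel _] ho]]] : exists (G : finGroupType)
    (h : {multiplicative free_group (std_gen r 0) -> G}), admissible p e h /\
    forall i, i != i0 -> #[h (gen_x 0 i)]%g = (p ^ logn p (e i))%N.
  have [r1|r1] := ltnP 1 r.
    pose i1 := Ordinal r1.
    have [|k k0|G [h [hA h1 hk]]] := @cyclic_quotient p r 0 e p_prime i1 => //.
      by rewrite dvdn_exp2l // e_sorted // k0.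
    exists G, h; split=> // i ni; have i_gt0 : (0 < i)%N.
      by rewrite lt0n -i00 (inj_eq val_inj).
    have [->//|ni1] := eqVneq i i1.
    rewrite hk // order1 a0 // ltn_neqAle i_gt0 andbT eq_sym.
    by rewrite -[1%N]/(val i1) (inj_eq val_inj).
  have [||h hA _] := @admissible_seq0 p r 0 e {perm 'I_0} [::] isT => //.
    by rewrite big_nil.
  exists _, h; split=> // i; rewrite -(inj_eq val_inj) /= i00 => ni.
  by have := leq_trans (ltn_ord i) r1; rewrite ltnS leqn0 (negPf ni).
apply: le_lt_trans (def_group_le_drop R p_prime e_gt0 fP hrel ho i00 _) _.
  by [].
rewrite lte_fin mulr0 sub0r addrC subr_lt0.
have [r1|r1] := ltnP 1 r.
  pose i1 := Ordinal r1; rewrite (bigD1 i1) /=; last first.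
    by rewrite -(inj_eq val_inj) /= i00.
  rewrite big1 ?addr0 => [|i /andP[ni ni1]].
    by rewrite gtrBl invr_gt0 exprn_gt0.
  rewrite a0 ?expr0 ?invr1 ?subrr // ltn_neqAle lt0n -[1%N]/(val i1) -i00.
  by rewrite !(inj_eq val_inj) eq_sym ni1.
rewrite big_pred0 ?ltr01 // => i; apply/negbTE.
rewrite negbK -(inj_eq val_inj) /= i00.
by have := leq_trans (ltn_ord i) r1; rewrite ltnS leqn0.
Qed.

(** Over the dihedral quotient the bound is -2 + (1 - 1/n) + 1/2 + 1/2 + 1/|image| = 1/|image| -
    1/n, negative as soon as the image is larger than its rotation subgroup of order n. *)
Lemma def_group_dihedral (i0 i1 i2 : 'I_r) : p = 2%N ->
  i0 = 0%N :> nat -> i1 = 1%N :> nat -> i2 = 2%N :> nat ->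
  (0 < logn p (e i0))%N -> logn p (e i1) = 1%N -> logn p (e i2) = 1%N ->
  (forall i : 'I_r, (2 < i)%N -> logn p (e i) = 0%N) ->
  (def_group p R Gamma < 0)%E.
Proof.
move=> p2 i00 i11 i22 a0 a1 a2 a3; set n := (p ^ logn p (e i0))%N.
have n1 : (1 < n)%N by rewrite -(exp1n (logn p (e i0))) ltn_exp2r // prime_gt1.
pose a := dihedral_rot n; pose b := dihedral_flip n.
have oa : #[a]%g = n by exact: order_dihedral_rot.
have ob : #[b]%g = 2 by exact: order_dihedral_flip.
have oc : #[(a * b)^-1]%g = 2 by rewrite orderV; exact: order_dihedral_mul.
have r3 : (3 <= r)%N by rewrite -i22.
pose l := [:: a; b; (a * b)^-1%g].
have ox (i : 'I_r) : #[nth 1%g l i]%g = (p ^ logn p (e i))%N.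
  case def_i: (i : nat) => [|[|[|k]]] /=.
  - by rewrite (_ : i = i0) ?oa //; apply: val_inj; rewrite /= def_i.
  - by rewrite (_ : i = i1) ?ob ?a1 ?p2 //; apply: val_inj; rewrite /= def_i.
  - by rewrite (_ : i = i2) ?oc ?a2 ?p2 //; apply: val_inj; rewrite /= def_i.
  - by rewrite nth_nil order1 a3 // def_i.
have [i _||h [hrel _] hx] := @admissible_seq0 p r 0 e _ l r3.
- by rewrite -ox expg_order.
- by rewrite !big_cons big_nil mulg1 mulgA mulgV.
have ho i : #[h (gen_x 0 i)]%g = (p ^ logn p (e i))%N by rewrite hx ox.
have : (#[a]%g < #|range_set h|)%N.
  apply: proper_card; apply/properP; split.
    rewrite (cycle_subG _ (range_group h)) (_ : a = h (gen_x 0 i0)).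
      exact: mem_range_set.
    by rewrite hx i00.
  exists b; last exact: dihedral_flip_notin.
  by rewrite (_ : b = h (gen_x 0 i1)) ?mem_range_set // hx i11.
rewrite oa => big_range.
have full := def_group_le_full R p_prime e_gt0 fP hrel (J := predT).
apply: le_lt_trans (full _ _) _ => //.
rewrite lte_fin (bigD1 i0) //= (bigD1 i1) /=; last first.
  by rewrite -(inj_eq val_inj) /= i00 i11.
rewrite (bigD1 i2) /=; last by rewrite -!(inj_eq val_inj) /= i00 i11 i22.
rewrite big1 => [|i /andP[/andP[ni0 ni1] ni2]]; last first.
  rewrite a3 ?expr0 ?invr1 ?subrr //; move: ni0 ni1 ni2.
  by rewrite -!(inj_eq val_inj) /= i00 i11 i22; case: (i : nat) => [|[|[|k]]].
rewrite a1 a2 expr1 -natrX -/n p2.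
have : (#|range_set h|%:R^-1 : R) < n%:R^-1.
  by rewrite ltf_pV2 ?posrE ?ltr0n ?ltr_nat // ltnW // ltnW.
by lra.
Qed.

End NonPositiveCases.

Theorem theorem14 (R : realType) (p : nat) (p_prime : prime p)
    (r s : nat) (e : 'I_r -> nat)
    (e_ge2 : forall i, (2 <= e i)%N)
    (e_sorted : forall i j : 'I_r,
       (i <= j)%N -> (logn p (e j) <= logn p (e i))%N)
    (Gamma : groupType)
    (iota : {multiplicative Gamma -> PSL2 R})
    (Gamma_fuchsian : fuchsian iota)
    (no_parabolic : forall g : Gamma, ~ parabolic (iota g))
    (f : {multiplicative free_group (std_gen r s) -> Gamma})
    (f_presentation : presentation (std_rel s e) f)
    (x_elliptic : forall i : 'I_r, elliptic (iota (f (gen_x s i))))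
    (x_order : forall (i : 'I_r) (n : nat),
       (f (gen_x s i) ^+ n)%g = 1%g <-> (e i %| n)%N) :
  (std_condition p s e ->
     def_group p R Gamma = def_pres p R (std_rel s e) /\
     def_group p R Gamma =
       (2 * s%:R - 2 + \sum_(i < r) (1 - p%:R ^- logn p (e i)))%:E) /\
  (~ std_condition p s e -> (def_group p R Gamma < 0)%E).
Proof.
have e_gt0 i : (0 < e i)%N by exact: ltnW.
split=> [cond|ncond].
  have rs0 : (0 < s)%N \/ (0 < r)%N.
    case: cond => [s0|[_ r3 _]|[_ r4 _]|[_ r3 _ _]]; [by left|right..].
    - exact: leq_trans r3.
    - exact: leq_trans r4.
    - exact: leq_trans r3.
  have le_sup : (def_pres p R (std_rel s e) <= def_group p R Gamma)%E.
    by apply: ereal_sup_ubound; exists (std_gen r s), (std_rel s e), f.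
  suff eq_sup : def_group p R Gamma = def_pres p R (std_rel s e).
    by split=> //; rewrite eq_sup def_pres_std.
  apply/eqP; rewrite eq_le le_sup andbT def_pres_std //.
  (* An image with more than truncn (1/eps) elements makes the error term 1/|image| at most eps. *)
  apply/lee_addgt0Pr => eps eps0; set n := Num.truncn eps^-1.
  have [G [h [hrel ho lt_n]]] := full_quotient p_prime e_gt0 e_sorted n cond.
  have full := def_group_le_full R p_prime e_gt0 f_presentation hrel.
  apply: le_trans (full predT _ _) _ => //.
  rewrite -EFinD lee_fin lerD2l.
  have n_gt : eps^-1 < #|range_set h|%:R.
    by apply: lt_le_trans (truncnS_gt _) _; rewrite ler_nat.
  rewrite -[leRHS]invrK lef_pV2 ?posrE ?invr_gt0 ?ltW //.
  by apply: lt_trans n_gt; rewrite invr_gt0.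
(* Indices start at 0. Failure of (1) gives s = 0. If p does not divide e_2, or r <= 2, at most two
   generators count and the cyclic bound applies. Otherwise failure of (2) forces p = 2, that of (4)
   forces e_1 and e_2 to have valuation 1, and that of (3) makes e_i odd for i >= 3: the dihedral
   pattern. *)
have s0 : s = 0%N.
  by apply/eqP; rewrite -leqn0 leqNgt; apply/negP => s0; apply/ncond/Or41.
subst s; have [r0|r0] := posnP r.
  exact (def_group_no_generator R p_prime f_presentation r0).
have cyclic := def_group_cyclic R p_prime e_gt0 e_sorted f_presentation.
have [r3|r3] := ltnP 2 r; last first.
  apply: (cyclic (Ordinal r0)) => // i i1.
  by have := leq_trans (ltn_ord i) r3; rewrite ltnNge i1.
pose i2 := Ordinal r3; have [a2|a2] := posnP (logn p (e i2)).
  apply: (cyclic (Ordinal r0)) => // i i1.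
  by apply/eqP; rewrite -leqn0 -a2; exact: e_sorted.
have p_e (i : 'I_r) : (i <= 2)%N -> (p %| e i)%N.
  move=> lei; rewrite -[p]expn1 pfactor_dvdn //.
  exact: leq_trans a2 (e_sorted i i2 lei).
have p2 : p = 2%N.
  apply/eqP; rewrite eqn_leq prime_gt1 // andbT leqNgt; apply/negP => p3.
  by apply: ncond; apply: Or42; split.
pose i1 := Ordinal (ltnW r3).
have a1_le : (logn p (e i1) <= 1)%N.
  rewrite leqNgt; apply/negP => a1; apply: ncond; apply: Or44; split=> // i.
    move=> lti; rewrite (_ : 4%N = p ^ 2)%N; last by rewrite p2.
    rewrite pfactor_dvdn //.
    exact: leq_trans a1 (e_sorted i i1 lti).
  by move=> ei; rewrite -p2 p_e // ei.
have a21 := e_sorted i1 i2 isT.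
apply: (def_group_dihedral R p_prime e_gt0 f_presentation (i0 := Ordinal r0)
  (i1 := i1) (i2 := i2)) => //.
- exact: leq_trans a2 (e_sorted _ _ _).
- by apply/eqP; rewrite eqn_leq a1_le (leq_trans a2).
- by apply/eqP; rewrite eqn_leq a2 (leq_trans a21).
move=> i i3; apply/eqP; rewrite -leqn0 leqNgt; apply/negP => ai.
apply: ncond; apply: Or43; split=> // [|k k4].
  by apply: leq_trans (ltn_ord i).
rewrite -[2%N]expn1 -p2 pfactor_dvdn //; apply: leq_trans ai (e_sorted k i _).
exact: leq_trans (ltnSE k4) i3.
Qed.
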